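(* Let $G$ be an amenable group generated by a finite symmetric set $S$, let $\mathcal A$ be a finite set and $\mathcal C:G\to\mathcal A$ a colouring. Let $(Q_n)_{n\in\mathbb N}$ be a Følner sequence in $G$ such that each $Q_n$ symmetrically tiles $G$, and let $(U_j)_{j\in\mathbb N}$ be a Følner sequence along which the frequencies $\nu_P=\lim_{j\to\infty}|U_j|^{-1}\sharp_P(\mathcal C|_{U_j})$ exist for all patterns $P\in\bigcup_{n\in\mathbb N}\mathcal P(Q_n)$. Let $\mathcal H$ be a finite dimensional Hilbert space and $H:\ell^2(G,\mathcal H)\to\ell^2(G,\mathcal H)$ a selfadjoint, $\mathcal C$-invariant operator of finite range, with overall range $R$. Then there exists a unique probability measure $\mu_H$ on $\mathbb R$ with distribution function $N_H$ such that $$\bigg\|\frac{n(H[U_{j,R}])}{\dim(\mathcal H)|U_{j,R}|}-N_H\bigg\|_\infty\le8\frac{|\partial^RQ_n|}{|Q_n|}+(1+4|B_R|)\frac{|\partial^{\operatorname{diam}(Q_n)}U_j|}{|U_j|}+\sum_{P\in\mathcal P(Q_n)}\Big|\frac{\sharp_P(\mathcal C|_{U_j})}{|U_j|}-\nu_P\Big|+\frac{|\partial^R_{int}U_j|}{|U_j|}$$ holds for all $j,n\in\mathbb N$. This implies in particular the convergence $$\frac{n(H[U_{j,R}])}{|U_{j,R}|\dim(\mathcal H)}\to N_H\quad\text{as } j\to\infty$$ with respect to the supremum norm. $N_H$ is called the integrated density of states.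
   Context: $e$ is the unit of $G$; symmetric means $S=S^{-1}$. Word metric: $d_S(g,h)$ is the minimal $L\in\mathbb N_0$ such that $g^{-1}h$ is a product of $L$ elements of $S$. $B_R(x)=\{g\in G: d_S(g,x)\le R\}$, $B_R=B_R(e)$. $\mathcal F(G)$ is the set of finite subsets of $G$, $|Q|$ is cardinality, $\operatorname{diam}(Q)=\max\{d_S(g,h): g,h\in Q\}$. For $Q\in\mathcal F(G)$ and $R\ge 0$: $\partial_{int}^R(Q)=\{x\in Q: d_S(x,G\setminus Q)\le R\}$, $\partial_{ext}^R(Q)=\{x\in G\setminus Q: d_S(x,Q)\le R\}$, $\partial^R(Q)=\partial^R_{int}(Q)\cup\partial^R_{ext}(Q)$, $Q_R=Q\setminus\partial^R(Q)$, and $U_{j,R}=(U_j)_R$ (expressions with $|U_{j,R}|$ in the denominator are understood for $U_{j,R}\neq\emptyset$). A Følner sequence is a sequence $(Q_n)$ of finite (nonempty) subsets of $G$ with $\lim_{n\to\infty} |Q_nS\setminus Q_n|/|Q_n|=0$. A set $Q\subseteq G$ symmetrically tiles $G$ if there is $K\subseteq G$ with $K=K^{-1}$ such that the sets $Qg$, $g\in K$, are pairwise disjoint and have union $G$. A colouring is a map $\mathcal C:G\to\mathcal A$; a pattern is a map $P:D(P)\to\mathcal A$ with $D(P)\in\mathcal F(G)$; $\mathcal P(Q)$ is the set of patterns with domain $Q$. The translate $Px$ ($x\in G$) is the pattern $D(P)x\to\mathcal A$, $yx\mapsto P(y)$ (the same notation is used for restrictions of $\mathcal C$). $\sharp_P(P')=|\{x\in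 G: D(P)x\subseteq D(P'),\ P'|_{D(P)x}=Px\}|$. The limit $\nu_P=\lim_j\sharp_P(\mathcal C|_{U_j})/|U_j|$, if it exists, is called the frequency of $P$ in $\mathcal C$ along $(U_j)$. $\ell^2(G,\mathcal H)$ is the Hilbert space of square summable functions $u:G\to\mathcal H$. For $x\in G$, $p_x(u)=u(x)$ and $i_x:\mathcal H\to\ell^2(G,\mathcal H)$, $i_x(h)(y)=h\delta_{xy}$. For $Q\subseteq G$, $p_Q:\ell^2(G,\mathcal H)\to\ell^2(Q,\mathcal H)$ is restriction, $i_Q$ is extension by zero, and $H[Q]=p_QHi_Q$. $H$ is of finite range if there is $M>0$ with $p_yHi_x=0$ for all $x,y\in G$ with $d_S(x,y)\ge M$. $H$ is $\mathcal C$-invariant if there is $N\in\mathbb N$ such that $p_yHi_x=p_{yt}Hi_{xt}$ for all $x,y,t\in G$ with $(\mathcal C|_{B_N(x)\cup B_N(y)})t=\mathcal C|_{B_N(xt)\cup B_N(yt)}$. The overall range is $R=\max\{M,N\}$ for such parameters $M,N$. For a selfadjoint operator $A$ on a finite dimensional Hilbert space, $n(A):\mathbb R\to\mathbb R$, $n(A)(E)$ is the number of eigenvalues of $A$, counted with multiplicity, that are $\le E$. The distribution function of a probability measure $\mu$ on $\mathbb R$ is $E\mapsto\mu((-\infty,E])$.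
   Formalization: The word metric is taken right-invariant (d_S(g,h) is the word length of gh^{-1}, not g^{-1}h) and Følner means |SQ_n\Q_n|/|Q_n| → 0, to match right translations; with the stated conventions the claim fails for noncommutative groups, e.g. the Heisenberg group. *)

(* Defs.v *)
From HB Require Import structures.
From mathcomp Require Import all_boot all_order all_algebra.
From mathcomp Require Import finmap.
From mathcomp Require Import complex ring lra.
From mathcomp Require Import all_classical all_reals all_analysis.
Set Implicit Arguments.
Unset Strict Implicit.
Unset Printing Implicit Defensive.
Import Order.TTheory GRing.Theory Num.Theory.
Import numFieldNormedType.Exports.
Local Open Scope classical_set_scope.
Local Open Scope ring_scope.

(* Convention: the word metric is the right-invariant one, built on g h^-1, so
   that the right translations x |-> x * t, which move patterns, tiles and
   matrix coefficients, are isometries.  The matching Følner condition uses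
   S Q \ Q, the exterior 1-boundary of Q.  With g^-1 h and Q S instead, right
   translations distort distances in a noncommutative group (and the existence
   of the integrated density of states fails, e.g. in the Heisenberg group);
   the two conventions agree when G is commutative. *)

Section WordMetric.
Context {G : groupType}.
Implicit Types (S Q : {fset G}) (g h x y t : G).

Definition symmetric_gens S : Prop := [fset (s^-1)%g | s in S]%fset = S.

Definition is_word S (L : nat) g : Prop :=
  exists s : seq G,
    [/\ size s = L, {subset s <= S} & g = (\prod_(a <- s) a)%g].

Definition generates S : Prop := forall g, exists L, is_word S L g.

Definition wdist S g h : nat :=
  xget 0%N [set L | is_word S L (g * h^-1)%g /\
                    forall L', is_word S L' (g * h^-1)%g -> (L <= L')%N].

Definition diam S Q : nat :=
  \max_(g : Q) \max_(h : Q) wdist S (val g) (val h).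

Definition rtrans Q x : {fset G} := [fset (y * x)%g | y in Q]%fset.

Lemma mem_rtransV Q x (z : rtrans Q x) : (val z * x^-1)%g \in Q.
Proof. by case: z => z /= /imfsetP[y /= yQ ->]; rewrite mulgK. Qed.

Definition symmetrically_tiles Q : Prop :=
  exists K : set G, [/\ [set (k^-1)%g | k in K] = K,
    trivIset K (fun g => [set` rtrans Q g]) &
    \bigcup_(g in K) [set` rtrans Q g] = [set: G]].

Context {R : realType}.
Implicit Type r : R.

(* For generating S the balls and boundaries are finite, hence [fset_set]
   (which sends infinite sets to the empty one) loses nothing. *)
Definition wball S r x : {fset G} :=
  fset_set [set g | ((wdist S g x)%:R <= r)].

Definition bdry_int S r Q : {fset G} :=
  fset_set [set x | x \in Q /\
                    exists2 y, y \notin Q & ((wdist S x y)%:R <= r)].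

Definition bdry_ext S r Q : {fset G} :=
  fset_set [set x | x \notin Q /\
                    exists2 y, y \in Q & ((wdist S x y)%:R <= r)].

Definition bdry S r Q : {fset G} := (bdry_int S r Q `|` bdry_ext S r Q)%fset.

Definition shrink S r Q : {fset G} := (Q `\` bdry S r Q)%fset.

Definition folner (T : realType) S (Q : nat -> {fset G}) : Prop :=
  (forall n, Q n != fset0) /\
  (fun n => #|` [fset (s * x)%g | s in S, x in Q n] `\` Q n|%fset%:R
            / #|` Q n|%:R : T) @ \oo --> (0 : T).

Definition amenable (T : realType) S : Prop :=
  exists Q : nat -> {fset G}, folner T S Q.

End WordMetric.

Section Patterns.
Context {G : groupType} {A : finType}.
Implicit Types (C : G -> A) (P : {fmap G -> A}) (Q : {fset G}).

(* A pattern is a finite map P : {fmap G -> A}, with domain domf P. *)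

Definition pat_restr C Q : {fmap G -> A} := [fmap x : Q => C (val x)].

Definition pat_trans P (x : G) : {fmap G -> A} :=
  [fmap z : rtrans (domf P) x => P.[mem_rtransV z]]%fmap.

Definition occurrences P (P' : {fmap G -> A}) : nat :=
  #|` fset_set [set x | (rtrans (domf P) x `<=` domf P')%fset /\
                        (P'.[& rtrans (domf P) x])%fmap = pat_trans P x]|%fset.

Definition pat_ratio (R : realType) C Q P : R :=
  (occurrences P (pat_restr C Q))%:R / #|` Q|%fset%:R.

Definition frequency (R : realType) C (U : nat -> {fset G}) P : R :=
  limn (fun j => pat_ratio R C (U j) P).

End Patterns.

Section SquareSummable.
Context {R : realType} {V : vectType R[i]}.
Variables (G : groupType) (dot : {dot V for Num.conj}).

Definition sqnorm (v : V) : R := complex.Re (dot v v).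

Lemma sqnormE (v : V) : dot v v = (sqnorm v)%:C%C.
Proof.
have : 0 <= dot v v by exact: dnorm_ge0.
rewrite /sqnorm; case: (dot v v) => a b.
by rewrite lecE /= => /andP[/eqP -> _].
Qed.

Lemma sqnorm_ge0 v : 0 <= sqnorm v.
Proof. by rewrite -lecR -sqnormE; exact: dnorm_ge0. Qed.

Lemma sqnormD_le u v : sqnorm (u + v) <= 2 * (sqnorm u + sqnorm v).
Proof.
have h : sqnorm (u + v) + sqnorm (u - v) = 2 * (sqnorm u + sqnorm v).
  have h' : dot (u + v) (u + v) + dot (u - v) (u - v) =
      (dot u u + dot v v) + (dot u u + dot v v).
    by rewrite (dnormD dot) (dnormB dot) /=; ring.
  move: h'; rewrite !sqnormE -!raddfD /= => -[->]; ring.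
by rewrite -h lerDl sqnorm_ge0.
Qed.

Lemma sqnormZ (a : R[i]) v :
  sqnorm (a *: v) = complex.Re `|a| ^+ 2 * sqnorm v.
Proof.
have := dnormZ dot a v; rewrite !sqnormE normc_def /= -rmorphXn -rmorphM.
by move=> [->].
Qed.

Definition square_summable (u : G -> V) : bool :=
  (\esum_(x in [set: G]) (sqnorm (u x))%:E < +oo)%E.

Lemma esum_dom (f g : G -> R) (c : R) : 0 <= c ->
  (forall x, 0 <= f x) -> (forall x, 0 <= g x) ->
  (forall x, f x <= c * g x) ->
  (\esum_(x in [set: G]) (g x)%:E < +oo ->
   \esum_(x in [set: G]) (f x)%:E < +oo)%E.
Proof.
move=> c0 f0 g0 fg sg.
apply: (@le_lt_trans _ _ (c%:E * \esum_(x in [set: G]) (g x)%:E)%E).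
  apply: ge_ereal_sup => _ [F [finF _] <-].
  apply: (@le_trans _ _ (c%:E * \sum_(x \in F) (g x)%:E)%E).
    rewrite ge0_mule_fsumr; last by move=> x; rewrite lee_fin.
    by apply: lee_fsum => // x _; rewrite -EFinM lee_fin.
  apply: lee_wpmul2l; first by rewrite lee_fin.
  by apply: ereal_sup_ubound; exists F.
by apply: lte_mul_pinfty => //; rewrite ?lee_fin.
Qed.

Definition l2_pred : {pred G -> V} := square_summable.

Lemma l2_pred_submod : submod_closed l2_pred.
Proof.
split.
  rewrite unfold_in /l2_pred /square_summable esum1// => x _.
  by rewrite /sqnorm linear0r.
move=> a u v; rewrite !unfold_in /l2_pred /square_summable => su sv.
pose c := 2 * (1 + complex.Re `|a| ^+ 2).
have n0 : 0 <= complex.Re `|a| ^+ 2 by rewrite sqr_ge0.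
apply: (@esum_dom _ (fun x => sqnorm (u x) + sqnorm (v x)) c).
- by rewrite /c mulr_ge0// addr_ge0.
- by move=> x; exact: sqnorm_ge0.
- by move=> x; rewrite addr_ge0 ?sqnorm_ge0.
- move=> x; rewrite /c -mulrA; apply: le_trans (sqnormD_le _ _) _.
  rewrite ler_pM2l// sqnormZ mulrDl mul1r mulrDr.
  have := sqnorm_ge0 (u x); have := sqnorm_ge0 (v x) => h1 h2.
  have := mulr_ge0 n0 h1; have := mulr_ge0 n0 h2; lra.
rewrite (eq_esum (b := fun x => ((sqnorm (u x))%:E + (sqnorm (v x))%:E)%E))//.
by rewrite esumD ?lte_add_pinfty// => x _; rewrite lee_fin sqnorm_ge0.
Qed.

HB.instance Definition _ := GRing.isSubmodClosed.Build R[i] (G -> V) l2_pred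
  l2_pred_submod.

Record l2 := L2 { l2_fun :> G -> V; _ : l2_fun \in l2_pred }.

HB.instance Definition _ := [isSub for l2_fun].
HB.instance Definition _ := [Choice of l2 by <:].
HB.instance Definition _ := [SubChoice_isSubLmodule of l2 by <:].

End SquareSummable.

Section Operators.
Context {R : realType} {V : vectType R[i]} {G : groupType}.
Context {dot : {dot V for Num.conj}}.
Implicit Types (S Q : {fset G}) (H : l2 G dot -> l2 G dot).

(* Sum of an absolutely summable family of reals. *)
Definition sumR (f : G -> R) : R :=
  fine (\esum_(x in [set: G]) (Num.max (f x) 0)%:E) -
  fine (\esum_(x in [set: G]) (Num.max (- f x) 0)%:E).

Definition l2_dot (u v : l2 G dot) : R[i] :=
  (sumR (fun x => complex.Re (dot (u x) (v x))) +i*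
   sumR (fun x => complex.Im (dot (u x) (v x))))%C.

(* H is defined on the whole space, so being equal to its adjoint amounts to
   being symmetric. *)
Definition selfadjoint H : Prop :=
  forall u v : l2 G dot, l2_dot (H u) v = l2_dot u (H v).

Definition ext0 Q (u : {ffun Q -> V}) (x : G) : V :=
  if insub x is Some q then u q else 0.

Lemma ext0_l2 Q (u : {ffun Q -> V}) : ext0 u \in l2_pred dot.
Proof.
rewrite unfold_in /l2_pred /square_summable.
rewrite (_ : esum _ _ = \esum_(x in [set` Q]) (sqnorm dot (ext0 u x))%:E)%E.
  rewrite esum_fset//; last by move=> x _; rewrite lee_fin sqnorm_ge0.
  by rewrite fsumEFin// ltry.
rewrite [RHS]esum_mkcond; apply: eq_esum => x _.
rewrite mem_setE; case: ifPn => // xQ.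
by rewrite /ext0 insubN// /sqnorm linear0r.
Qed.

Definition iQ Q (u : {ffun Q -> V}) : l2 G dot := L2 (ext0_l2 u).

Definition pQ Q (u : l2 G dot) : {ffun Q -> V} := [ffun x : Q => u (val x)].

Lemma iQ_is_linear Q : linear (@iQ Q).
Proof.
move=> a u v; apply/val_inj/funext => x /=.
change (ext0 (a *: u + v) x = a *: ext0 u x + ext0 v x).
rewrite /ext0; case: insubP => [q _ _|_]; first by rewrite !ffunE.
by rewrite scaler0 addr0.
Qed.

HB.instance Definition _ Q := GRing.isLinear.Build R[i] {ffun Q -> V}
  (l2 G dot) _ (@iQ Q) (@iQ_is_linear Q).

Lemma pQ_is_linear Q : linear (@pQ Q).
Proof. by move=> a u v; apply/ffunP => x; rewrite !ffunE. Qed.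

HB.instance Definition _ Q := GRing.isLinear.Build R[i] (l2 G dot)
  {ffun Q -> V} _ (@pQ Q) (@pQ_is_linear Q).

Definition ipt (x : G) (h : V) : l2 G dot :=
  iQ [ffun _ : [fset x]%fset => h].

Lemma iptE x h y : ipt x h y = if y == x then h else 0.
Proof.
rewrite /ipt /= /ext0; case: insubP => [q|].
  by rewrite inE => -> _; rewrite ffunE.
by rewrite inE => /negbTE ->.
Qed.

Definition ppt (x : G) (u : l2 G dot) : V := u x.

Definition compress (H : {linear l2 G dot -> l2 G dot}) Q :
    'End({ffun Q -> V}) :=
  linfun (pQ Q \o H \o @iQ Q).

Definition finite_range S H (M : R) : Prop :=
  forall x y, M <= (wdist S x y)%:R -> forall h, ppt y (H (ipt x h)) = 0.

Definition colour_invariant (A : finType) (C : G -> A) S H (N : nat) : Prop :=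
  let B x y := (wball S (N%:R : R) x `|` wball S (N%:R : R) y)%fset in
  forall x y t,
    pat_trans (pat_restr C (B x y)) t =
      pat_restr C (B (x * t)%g (y * t)%g) ->
    forall h, ppt y (H (ipt x h)) = ppt (y * t)%g (H (ipt (x * t)%g h)).

End Operators.

Section Counting.
Context {R : realType}.

(* Meant for selfadjoint T: all eigenvalues are then real, and the
   multiplicity of an eigenvalue is the dimension of its eigenspace.  Only
   finitely many terms of the sum are nonzero. *)
Definition eigen_count (W : vectType R[i]) (T : 'End(W)) (E : R) : nat :=
  \big[addn/0%N]_(l \in [set l : R | l <= E]) \dim (passmx.leigenspace T l%:C%C).

Definition distribution_function (mu : probability (measurableTypeR R) R) (E : R) : R :=
  fine (mu [set x | x <= E]).

Definition supnorm (f : R -> R) : \bar R :=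
  ereal_sup [set `|f E|%:E | E in [set: R]].

Definition normalized_count (V : vectType R[i]) (G : groupType)
    (dot : {dot V for Num.conj}) (H : {linear l2 G dot -> l2 G dot})
    (Q : {fset G}) (E : R) : R :=
  (eigen_count (compress H Q) E)%:R / ((\dim {:V})%:R * #|` Q|%fset%:R).

Definition ids_error (G : groupType) (A : finType) (S : {fset G}) (C : G -> A)
    (Q U : nat -> {fset G}) (r : R) (j n : nat) : R :=
  8 * (#|` bdry S r (Q n)|%fset%:R / #|` Q n|%fset%:R)
  + (1 + 4 * #|` wball S r 1%g|%fset%:R)
    * (#|` bdry S ((diam S (Q n))%:R : R) (U j)|%fset%:R / #|` U j|%fset%:R)
  + \sum_(f : {ffun Q n -> A})
      `|pat_ratio R C (U j) (FinMap f) - frequency R C U (FinMap f)|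
  + #|` bdry_int S r (U j)|%fset%:R / #|` U j|%fset%:R.

End Counting.

(* Main.v *)
(* Write n(Q) for the eigenvalue counting function of H[Q] at a fixed energy.
   By Courant-Fischer, n(Q) is the dimension of a maximal subspace on which the
   quadratic form of H[Q] - E is nonpositive.  Comparing such subspaces shows
   that n is monotone in Q, grows by at most dim V per added point, is additive
   over sets at distance larger than the range, and is constant along pattern
   occurrences.

   Let K = K^-1 be a tiling grid for Q.  For q in Q the translates Qz inside U
   with zq in K are disjoint and cover U up to its interior boundary of width
   diam Q.  By symmetry of K every z has zq in K for exactly one q in Q, so
   averaging over q in Q turns the tilings into the sum over all z with Qz
   inside U, that is, into pattern frequencies.  This compares n(U_j) / |U_j|
   with a mean L_n over the patterns on Q_n weighted by their frequencies.  The
   error intervals around the L_n pairwise meet, and their common point is the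
   integrated density of states; being a uniform limit of normalized counting
   functions, it is a distribution function. *)
From HB Require Import structures.
Require Import Defs.
From mathcomp Require Import all_boot all_order all_algebra.
From mathcomp Require Import finmap spectral complex ring lra zify.
From mathcomp Require Import all_classical all_reals all_analysis.
Set Implicit Arguments.
Unset Strict Implicit.
Unset Printing Implicit Defensive.
Import Order.TTheory GRing.Theory Num.Theory.
Import numFieldNormedType.Exports.
Local Open Scope classical_set_scope.
Local Open Scope ring_scope.

(* If q is a Hermitian form shifted by E and n its number of eigenvalues <= E,
   the two spectral subspaces witness [sign_split q n]; conversely any two
   witnesses have the same n, since a nonpositive and a positive subspace meet
   only in 0. *)
Definition sign_split (K : fieldType) (R : realType) (W : vectType K)
    (q : W -> R) (n : nat) : Prop :=
  exists A B : {vspace W}, [/\ \dim A = n, (\dim A + \dim B)%N = \dim {:W},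
    forall w, w \in A -> q w <= 0 & forall w, w \in B -> w != 0 -> 0 < q w].

(** * Dimension counts for forms with a sign split *)

Section Signature.
Context {K : fieldType} {R : realType}.

Lemma dim_neg_pos (W : vectType K) (q : W -> R) (A B : {vspace W}) :
  (forall w, w \in A -> q w <= 0) -> (forall w, w \in B -> w != 0 -> 0 < q w) ->
  (\dim A + \dim B <= \dim {:W})%N.
Proof.
move=> qA qB; rewrite -dimv_disjoint_sum ?dimvS ?subvf//.
apply/eqP; rewrite -subv0; apply/subvP => w; rewrite memv_cap memv0.
move=> /andP[wA wB]; apply: contraT => w0.
by have := qB _ wB w0; rewrite ltNge qA.
Qed.

(** In [W'] the image of [A] meets [B'] only in 0, and [A'] meets the image of [B] only in 0. The
    two dimension counts are a coarse form of eigenvalue interlacing. *)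
Lemma sign_split_sub (W W' : vectType K) (q : W -> R) (q' : W' -> R)
    (e : 'Hom(W, W')) n n' :
  lker e = 0%VS -> (forall u, q' (e u) = q u) ->
  sign_split q n -> sign_split q' n' ->
  (n <= n')%N /\ (n' + \dim {:W} <= n + \dim {:W'})%N.
Proof.
move=> ke qe [A [B [<- dAB qA qB]]] [A' [B' [<- dAB' qA' qB']]].
have dime X : \dim (e @: X) = \dim X by rewrite limg_dim_eq// ke capv0.
have := @dim_neg_pos _ q' (e @: A)%VS B'.
have := @dim_neg_pos _ q' A' (e @: B)%VS; rewrite !dime => h1 h2.
have {}h1 : (\dim A' + \dim B <= \dim {:W'})%N.
  apply: h1 => // _ /memv_imgP[u uB ->] eu0; rewrite qe qB//.
  by apply: contraNneq eu0 => ->; rewrite linear0.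
have {}h2 : (\dim A + \dim B' <= \dim {:W'})%N.
  by apply: h2 => // _ /memv_imgP[u uA ->]; rewrite qe qA.
split; lia.
Qed.

(** The sums of the images of the nonpositive and of the positive parts have complementary
    dimensions in [W]; comparing them with [B] and [A] bounds [n] from both sides. *)
Lemma sign_split_add (W1 W2 W : vectType K) (q1 : W1 -> R) (q2 : W2 -> R)
    (q : W -> R) (e1 : 'Hom(W1, W)) (e2 : 'Hom(W2, W)) n1 n2 n :
  (forall u1 u2, e1 u1 + e2 u2 = 0 -> u1 = 0 /\ u2 = 0) ->
  (forall u1 u2, q (e1 u1 + e2 u2) = q1 u1 + q2 u2) ->
  q1 0 = 0 -> q2 0 = 0 -> (\dim {:W1} + \dim {:W2})%N = \dim {:W} ->
  sign_split q1 n1 -> sign_split q2 n2 -> sign_split q n -> n = (n1 + n2)%N.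
Proof.
move=> inj qe q10 q20 dW [A1 [B1 [<- d1 qA1 qB1]]] [A2 [B2 [<- d2 qA2 qB2]]].
move=> [A [B [<- d qA qB]]].
have k1 : lker e1 = 0%VS.
  apply/eqP; rewrite -subv0; apply/subvP => u; rewrite memv_ker memv0 => /eqP eu.
  by have [|->] := inj u 0; rewrite // linear0 eu addr0.
have k2 : lker e2 = 0%VS.
  apply/eqP; rewrite -subv0; apply/subvP => u; rewrite memv_ker memv0 => /eqP eu.
  by have [|_ ->] := inj 0 u; rewrite // linear0 eu addr0.
have dime X Y : \dim (e1 @: X + e2 @: Y) = (\dim X + \dim Y)%N.
  rewrite dimv_disjoint_sum ?limg_dim_eq ?k1 ?k2 ?capv0//.
  apply/eqP; rewrite -subv0; apply/subvP => w; rewrite memv_cap memv0.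
  move=> /andP[/memv_imgP[u _ ->] /memv_imgP[v _ uv]].
  have [|-> _] := inj u (- v); last by rewrite linear0.
  by rewrite uv linearN/= subrr.
have h1 : (\dim (e1 @: A1 + e2 @: A2)%VS + \dim B <= \dim {:W})%N.
  apply: (dim_neg_pos (q := q)) => // _
    /memv_addP[x /memv_imgP[u uA ->] [y /memv_imgP[v vA ->] ->]].
  by rewrite qe -(addr0 0) lerD ?qA1 ?qA2.
have h2 : (\dim A + \dim (e1 @: B1 + e2 @: B2)%VS <= \dim {:W})%N.
  apply: (dim_neg_pos (q := q)) => // _
    /memv_addP[x /memv_imgP[u uB ->] [y /memv_imgP[v vB ->] ->]] uv0.
  rewrite qe.
  have [u0|u0] := eqVneq u 0; have [v0|v0] := eqVneq v 0.
  - by move: uv0; rewrite u0 v0 !linear0 addr0 eqxx.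
  - by rewrite u0 q10 add0r qB2.
  - by rewrite v0 q20 addr0 qB1.
  - by rewrite addr_gt0 ?qB1 ?qB2.
move: h1 h2; rewrite !dime; lia.
Qed.
End Signature.

(** * Spectral theorem for a selfadjoint endomorphism in finite dimension *)

Section Spectral.
Context {R : realType} {W : vectType R[i]} (d : W -> W -> R[i]) (T : 'End(W)).
Hypothesis dl : forall a u v w, d (a *: u + v) w = a * d u w + d v w.
Hypothesis dC : forall u v, d u v = Num.conj (d v u).
Hypothesis d_gt0 : forall u, u != 0 -> 0 < d u u.
Hypothesis dT : forall u v, d (T u) v = d u (T v).

Let d0l w : d 0 w = 0.
Proof. by have := dl (-1) 0 0 w; rewrite scaler0 addr0 mulN1r addNr. Qed.
Let dDl u v w : d (u + v) w = d u w + d v w.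
Proof. by have := dl 1 u v w; rewrite scale1r mul1r. Qed.
Let dZl a u w : d (a *: u) w = a * d u w.
Proof. by have := dl a u 0 w; rewrite !addr0 d0l addr0. Qed.
Let d0r w : d w 0 = 0. Proof. by rewrite dC d0l rmorph0. Qed.
Let dDr u v w : d w (u + v) = d w u + d w v.
Proof. by rewrite dC dDl rmorphD/= -!dC. Qed.
Let dZr a u w : d w (a *: u) = Num.conj a * d w u.
Proof. by rewrite dC dZl rmorphM/= -dC. Qed.
Let dd_eq0 u : d u u = 0 -> u = 0.
Proof. by move=> uu; apply/eqP/contraT => /d_gt0; rewrite uu ltxx. Qed.

(** The matrix of [T] on a basis of [X] has an eigenvalue because [R[i]] is algebraically closed; a
    row eigenvector holds the coordinates of [v]. *)
Lemma invariant_eigenvector (X : {vspace W}) :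
  X != 0%VS -> (T @: X <= X)%VS ->
  exists v a, [/\ v \in X, v != 0 & T v = a *: v].
Proof.
move=> X0 TX; pose b := vbasis X.
pose A : 'M[R[i]]_(\dim X) := \matrix_(i, j) coord b j (T b`_i).
have [a /eigenvalueP[w wA w0]] : exists a, eigenvalue A a.
  by apply: eigenvalue_closed; rewrite lt0n dimv_eq0.
exists (\sum_i w 0 i *: b`_i), a; split.
- apply: memv_suml => i _; apply: memvZ; apply: vbasis_mem; apply: mem_nth.
  by rewrite size_tuple.
- apply: contraNneq w0 => sw; apply/eqP/rowP => i.
  by have /freeP/(_ _ sw i) := basis_free (vbasisP X); rewrite mxE.
- rewrite linear_sum/= scaler_sumr.
  transitivity (\sum_i \sum_j (w 0 i * A i j) *: b`_j).
    apply: eq_bigr => i _; rewrite linearZ/=.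
    have -> : T b`_i = \sum_j coord b j (T b`_i) *: b`_j.
      apply: coord_vbasis; apply: (subvP TX); apply: memv_img.
      by apply: vbasis_mem; apply: mem_nth; rewrite size_tuple.
    by rewrite scaler_sumr; apply: eq_bigr => j _; rewrite scalerA mxE.
  rewrite exchange_big/=; apply: eq_bigr => j _; rewrite -scaler_suml scalerA.
  by congr (_ *: _); have /rowP/(_ j) := wA; rewrite !mxE.
Qed.

(** Orthogonal eigenvectors, not normalized, are paired with their eigenvalues, so that selecting by
    eigenvalue gives a sublist. The type makes the eigenvalues real. *)
Definition eigensystem (s : seq (R * W)) : bool :=
  all (fun p => (p.2 != 0) && (T p.2 == p.1%:C%C *: p.2)) s
  && pairwise (fun p q => d p.2 q.2 == 0) s.

Lemma eigensystem_subseq s s' :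
  subseq s s' -> eigensystem s' -> eigensystem s.
Proof.
move=> ss /andP[h1 h2]; apply/andP; split; last exact: subseq_pairwise h2.
by apply/allP => p /(mem_subseq ss); move/allP: h1; apply.
Qed.

Local Notation espan s := (span [seq p.2 | p <- s]).

Lemma orthogonal_span w (s : seq W) :
  (forall v, v \in s -> d w v = 0) -> forall x, x \in span s -> d w x = 0.
Proof.
elim: s => [|v s IH] h x; first by rewrite span_nil memv0 => /eqP ->.
rewrite span_cons => /memv_addP[z /vlineP[k ->] [y ys ->]].
rewrite dDr dZr h ?mem_head// mulr0 add0r IH// => u us.
by rewrite h// in_cons us orbT.
Qed.

Lemma eigensystem_head p s x :
  eigensystem (p :: s) -> x \in espan s -> d p.2 x = 0.
Proof.
case/andP=> _ /=/andP[/allP h _]; apply: orthogonal_span => _ /mapP[q qs ->].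
exact/eqP/h.
Qed.

Lemma eigensystem_dim s : eigensystem s -> \dim (espan s) = size s.
Proof.
move=> es; rewrite -(size_map snd); apply/eqP.
rewrite -/(free _); elim: s es => [|p s IH] es; first exact: nil_free.
rewrite /= free_cons IH ?andbT; last exact: eigensystem_subseq (subseq_cons _ _) es.
apply/negP => /(eigensystem_head es) /dd_eq0 p0.
by move: es; rewrite /eigensystem/= p0 eqxx.
Qed.

(** Diagonalizes both forms at once: if [x] has coefficients $k_i$ in the orthogonal vectors $p_i$,
    the weights are $c_i=|k_i|^2d(p_i,p_i)$. Invariance of the span is carried along so that the
    head vector is orthogonal to the image of the tail. *)
Lemma eigensystem_form s x : eigensystem s -> x \in espan s ->
  exists c : seq R, [/\ size c = size s, all (fun a => 0 <= a) c,
    d x x = (\sum_(i < size s) c`_i)%:C%C,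
    d (T x) x = (\sum_(i < size s) c`_i * (nth (0, 0) s i).1)%:C%C &
    T x \in espan s].
Proof.
elim: s x => [|p s IH] x es.
  rewrite span_nil memv0 => /eqP ->; exists [::]; split => //=.
  - by rewrite big_ord0 d0l.
  - by rewrite big_ord0 d0r.
  - by rewrite linear0 mem0v.
have es' : eigensystem s by exact: eigensystem_subseq (subseq_cons _ _) es.
rewrite /= span_cons => /memv_addP[z /vlineP[k ->] [y ys ->]].
have [c [sc c0 cy cT Ty]] := IH y es' ys.
have py := eigensystem_head es ys; have pTy := eigensystem_head es Ty.
have yp : d y p.2 = 0 by rewrite dC py rmorph0.
have Typ : d (T y) p.2 = 0 by rewrite dC pTy rmorph0.
have /andP[/=/andP[/andP[p0 /eqP Tp] _] _] := es.
pose n := complex.Re (k * Num.conj k * d p.2 p.2).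
have n0' : 0 <= k * Num.conj k * d p.2 p.2.
  by rewrite mulr_ge0 ?mul_conjC_ge0 ?ltW ?d_gt0.
have nE : k * Num.conj k * d p.2 p.2 = n%:C%C.
  by move: n0'; rewrite /n; case: (_ * _) => a b; rewrite lecE => /andP[/eqP/= -> _].
have n0 : 0 <= n by rewrite -lecR -nE.
exists (n :: c); split => /=.
- by rewrite sc.
- by rewrite n0.
- rewrite big_ord_recl/= rmorphD/= -cy -nE.
  by rewrite dDl !dDr !dZl !dZr py yp; ring.
- rewrite big_ord_recl/= rmorphD rmorphM/= -cT -nE.
  rewrite linearD linearZ/= Tp dDl !dDr !dZl !dZr py Typ; ring.
- rewrite linearD linearZ/= Tp memv_add//.
  by rewrite scalerA mulrC -scalerA memvZ// memvZ// memv_line.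
Qed.

(** Induction on the dimension: an eigenvector [v] is split off, and its orthogonal complement
    inside [X] is again invariant by selfadjointness. *)
Lemma eigensystem_exists (X : {vspace W}) : (T @: X <= X)%VS ->
  exists s, [/\ eigensystem s, size s = \dim X & (espan s <= X)%VS].
Proof.
move dX : (\dim X) => n; elim: n X dX => [|n IH] X dX TX.
  by exists [::]; split => //=; rewrite span_nil sub0v.
have [|v [a [vX v0 Tv]]] := invariant_eigenvector _ TX.
  by rewrite -dimv_eq0 dX.
have aR : a = (complex.Re a)%:C%C.
  have : a * d v v = Num.conj a * d v v by rewrite -dZl -Tv dT Tv dZr.
  move/(mulIf (lt0r_neq0 (d_gt0 v0))).
  case: a {Tv} => x y [] => yN; congr (_ +i* _)%C; lra.
have lphi : linear (fun w : W => d w v : R[i]^o) by move=> k x y; rewrite dl.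
pose phi0 : {linear W -> R[i]^o} := HB.pack (fun w : W => d w v : R[i]^o)
  (GRing.isLinear.Build _ _ _ _ _ lphi).
pose phi : 'Hom(W, R[i]^o) := linfun phi0.
have phiE w : phi w = d w v by rewrite lfunE.
pose Y := (X :&: lker phi)%VS.
have YP w : (w \in Y) = (w \in X) && (d w v == 0).
  by rewrite memv_cap memv_ker phiE.
have dY : \dim Y = n.
  have := limg_ker_dim phi X; rewrite -/Y dX.
  have -> : (phi @: X = {:R[i]^o})%VS.
    apply/eqP; rewrite eqEdim subvf/= dimvf/= lt0n dimv_eq0.
    apply: contraNneq (lt0r_neq0 (d_gt0 v0)) => i0.
    have : phi v \in (phi @: X)%VS by rewrite memv_img.
    by rewrite i0 memv0 phiE.
  rewrite dimvf /dim/=; lia.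
have TY : (T @: Y <= Y)%VS.
  apply/subvP => _ /memv_imgP[w + ->]; rewrite !YP => /andP[wX /eqP wv].
  by rewrite (subvP TX) ?memv_img//= dT Tv dZr wv mulr0.
have [s [es ss sY]] := IH Y dY TY.
exists ((complex.Re a, v) :: s); split => /=.
- rewrite /eigensystem/= v0 Tv -aR eqxx/=; case/andP: es => -> ->; rewrite !andbT.
  apply/allP => p ps; have : p.2 \in Y.
    by apply: (subvP sY); apply: memv_span; apply/mapP; exists p.
  by rewrite YP dC => /andP[_ /eqP]/eqP; rewrite fmorph_eq0.
- by rewrite ss.
- rewrite span_cons subv_add -memvE vX/=; apply: subv_trans sY _; exact: capvSl.
Qed.

(** The vectors of [s1] lie in the eigenspace, which gives one inequality. Conversely, an
    eigenvector for [l] is orthogonal to [s2], so the eigenspace meets the span of [s2] only in 0,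
    and [size s] is the full dimension. *)
Lemma eigenspace_count s (l : R) : eigensystem s -> size s = \dim {:W} ->
  \dim (passmx.leigenspace T l%:C%C) = count (fun p => p.1 == l) s.
Proof.
move=> es ss; pose s1 := seq.filter (fun p => p.1 == l) s.
pose s2 := seq.filter (fun p => p.1 != l) s.
have e1 : eigensystem s1 by apply: eigensystem_subseq es; exact: filter_subseq.
have e2 : eigensystem s2 by apply: eigensystem_subseq es; exact: filter_subseq.
have LP w : (w \in passmx.leigenspace T l%:C%C) = (T w == l%:C%C *: w).
  by rewrite memv_ker add_lfunE opp_lfunE scale_lfunE id_lfunE subr_eq0.
apply/anti_leq/andP; split; last first.
  rewrite -size_filter -(eigensystem_dim e1) dimvS//.
  apply/span_subvP => _ /mapP[p + ->]; rewrite mem_filter => /andP[/eqP pl ps].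
  by case/andP: es => /allP/(_ p ps)/andP[_]; rewrite LP pl.
have h : (\dim (passmx.leigenspace T l%:C%C) + size s2 <= size s)%N.
  rewrite -(eigensystem_dim e2) ss -dimv_disjoint_sum ?dimvS ?subvf//.
  apply/eqP; rewrite -subv0; apply/subvP => w; rewrite memv_cap memv0 LP.
  move=> /andP[/eqP Tw ws2]; apply/eqP/dd_eq0.
  apply: (orthogonal_span _ ws2) => _ /mapP[p + ->].
  rewrite mem_filter => /andP[pl ps].
  have /andP[/allP/(_ p ps)/andP[_ /eqP Tp] _] := es.
  have := dT w p.2; rewrite Tw Tp dZl dZr => /eqP.
  rewrite -subr_eq0 -mulrBl mulf_eq0 => /orP[|/eqP//].
  have -> : Num.conj p.1%:C%C = p.1%:C%C :> R[i] by rewrite /Num.conj/= oppr0.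
  by rewrite -rmorphB/= fmorph_eq0 subr_eq0 eq_sym (negbTE pl).
have sc : (count (fun p => p.1 == l) s + size s2 = size s)%N.
  by rewrite size_filter count_predC.
by rewrite -(leq_add2r (size s2)) sc.
Qed.

(** Turns the sum over real numbers in [eigen_count] into a count in a finite list of eigenvalues;
    the same list [ls] serves all energies. *)
Lemma eigen_countE : exists ls : seq R, size ls = \dim {:W} /\
  forall E, eigen_count T E = count (fun l => l <= E) ls /\
    sign_split (fun w => complex.Re (d (T w) w) - E * complex.Re (d w w))
      (eigen_count T E).
Proof.
have [s [es ss _]] := eigensystem_exists (subvf (T @: fullv)).
exists (map fst s); split; first by rewrite size_map.
move=> E.
have cE : eigen_count T E = count (fun l => l <= E) (map fst s).
  have h (l : R) := eigenspace_count l es ss.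
  pose r := [seq l <- map fst s | l <= E].
  have hr l : l <= E -> \dim (passmx.leigenspace T l%:C%C) = count_mem l r.
    move=> lE; rewrite h count_filter count_map; apply: eq_count => p /=.
    by case: eqP => //= ->; rewrite lE.
  have iterE n : iterop n addn 1%N 0%N = n.
    by elim: n => [|[|n] IH]//; rewrite -[in RHS]IH.
  rewrite /eigen_count (@fsbigE _ _ _ _ _ (undup r)) ?undup_uniq//.
  - rewrite -size_filter -/r -sum1_size.
    transitivity (\sum_(l <- undup r) iterop (count_mem l r) addn 1%N 0%N)%N.
      rewrite [LHS]big_seq_cond [RHS]big_seq; apply: eq_big => l; last first.
        by rewrite iterE => /andP[_]; rewrite in_setE => /hr.
      rewrite mem_undup mem_filter; case: (boolP (l <= E)) => //= lE.
      by rewrite mem_set// andbT.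
    exact: (big_undup_iterop_count addn).
  - by move=> l; rewrite /= mem_undup mem_filter => /andP[].
  - move=> l lE; rewrite hr// mem_undup => lr; apply/eqP.
    by rewrite eqn0Ngt -has_count has_pred1.
split => //; rewrite cE.
have esf (a : pred R) : eigensystem (seq.filter (fun p => a p.1) s).
  by apply: eigensystem_subseq es; exact: filter_subseq.
exists (espan (seq.filter (fun p => p.1 <= E) s)),
  (espan (seq.filter (fun p => ~~ (p.1 <= E)) s)).
have ep := esf (fun l => l <= E); have en := esf (fun l => ~~ (l <= E)).
rewrite (eigensystem_dim ep) (eigensystem_dim en); split.
- by rewrite size_filter count_map.
- by rewrite !size_filter count_predC.
- move=> w /(eigensystem_form ep)[c [sc /allP c0 -> -> _]]/=.
  rewrite mulr_sumr -sumrB; apply: sumr_le0 => i _.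
  rewrite mulrC -mulrBl mulr_le0_ge0//; last by rewrite c0// mem_nth// sc.
  rewrite subr_le0.
  by have := mem_nth (0, 0) (ltn_ord i); rewrite mem_filter => /andP[].
- move=> w /(eigensystem_form en).
  set s' := seq.filter _ s => -[c [sc /allP c0 wE -> _]]/= w0; rewrite wE/=.
  have c0i (i : 'I_(size s')) : 0 <= c`_i by rewrite c0// mem_nth// sc.
  have si (i : 'I_(size s')) : 0 < (nth (0, 0) s' i).1 - E.
    rewrite subr_gt0 ltNge.
    by have := mem_nth (0, 0) (ltn_ord i); rewrite mem_filter => /andP[].
  have tE i : c`_i * (nth (0, 0) s' i).1 - E * c`_i =
      c`_i * ((nth (0, 0) s' i).1 - E) by ring.
  rewrite mulr_sumr -sumrB lt_def; apply/andP; split; last first.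
    by apply: sumr_ge0 => i _; rewrite tE mulr_ge0// ltW.
  (* A vanishing sum of nonnegative terms forces every weight to be 0, since each eigenvalue here
     exceeds [E]; then [d w w] is 0. *)
  apply: contraNneq w0 => /eqP; rewrite psumr_eq0; last first.
    by move=> i _; rewrite tE mulr_ge0// ltW.
  move=> /allP z; apply/eqP/dd_eq0; rewrite wE big1// => i _.
  have := z i (mem_index_enum i); rewrite /= tE mulf_eq0 => /orP[/eqP//|].
  by rewrite (gt_eqF (si i)).
Qed.

End Spectral.

(** * Eigenvalue counts of compressions to finite sets *)

Section Compression.
Context {R : realType} {V : vectType R[i]} {G : groupType}.
Context {dot : {dot V for Num.conj}} (H : {linear l2 G dot -> l2 G dot}).
Hypothesis Hsym : selfadjoint H.
Implicit Types (Q : {fset G}) (x y t : G).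

Let dotl a u v w : dot (a *: u + v) w = a * dot u w + dot v w.
Proof. by rewrite linearDl/= linearZl_LR. Qed.
Let dotC u v : dot u v = Num.conj (dot v u).
Proof. by rewrite hermC expr0 mul1r. Qed.
Let dot0l v : dot 0 v = 0. Proof. by rewrite linear0l. Qed.
Let dot0r v : dot v 0 = 0. Proof. by rewrite linear0r. Qed.

Definition ffun_dot Q (u v : {ffun Q -> V}) : R[i] := \sum_x dot (u x) (v x).

Lemma ffun_dotl Q a (u v w : {ffun Q -> V}) :
  ffun_dot (a *: u + v) w = a * ffun_dot u w + ffun_dot v w.
Proof.
rewrite /ffun_dot mulr_sumr -big_split/=; apply: eq_bigr => x _.
by rewrite !ffunE dotl.
Qed.

Lemma ffun_dotC Q (u v : {ffun Q -> V}) :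
  ffun_dot u v = Num.conj (ffun_dot v u).
Proof. by rewrite /ffun_dot rmorph_sum; apply: eq_bigr => x _; exact: dotC. Qed.

Lemma ffun_dot_gt0 Q (u : {ffun Q -> V}) : u != 0 -> 0 < ffun_dot u u.
Proof.
move=> u0; rewrite lt_def sumr_ge0 ?andbT; last by move=> x _; exact: dnorm_ge0.
apply: contraNneq u0 => /eqP; rewrite psumr_eq0; last by move=> x _; exact: dnorm_ge0.
move=> /allP h; apply/eqP/ffunP => x; rewrite ffunE.
by apply/eqP; rewrite -(dnorm_eq0 dot); exact: h (mem_index_enum x).
Qed.

Lemma ext0E Q (u : {ffun Q -> V}) (x : Q) : ext0 u (val x) = u x.
Proof. by rewrite /ext0 valK. Qed.

Lemma ext0_out Q (u : {ffun Q -> V}) x : x \notin Q -> ext0 u x = 0.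
Proof. by move=> xQ; rewrite /ext0 insubN. Qed.

Lemma sumR_fset Q (f : G -> R) :
  (forall x, x \notin Q -> f x = 0) -> sumR f = \sum_(x <- Q) f x.
Proof.
move=> f0.
have pos (g : G -> R) : (forall x, x \notin Q -> g x = 0) -> (forall x, 0 <= g x) ->
    fine (\esum_(x in [set: G]) (g x)%:E)%E = \sum_(x <- Q) g x.
  move=> g0 g_ge0.
  rewrite (_ : esum _ _ = \esum_(x in [set` Q]) (g x)%:E)%E.
    rewrite esum_fset//; last by move=> x _; rewrite lee_fin.
    by rewrite fsumEFin// -fsbig_seq.
  rewrite [RHS]esum_mkcond; apply: eq_esum => x _.
  by rewrite mem_setE; case: ifPn => // /g0 ->.
rewrite /sumR !pos.
- rewrite -sumrB; apply: eq_bigr => x _.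
  by case: (lerP (f x) 0); case: (lerP (- f x) 0); lra.
- by move=> x /f0 ->; rewrite oppr0 maxxx.
- by move=> x; rewrite le_max lexx orbT.
- by move=> x /f0 ->; rewrite maxxx.
- by move=> x; rewrite le_max lexx orbT.
Qed.

Lemma l2_dot_fset Q (u v : l2 G dot) :
  (forall x, x \notin Q -> dot (u x) (v x) = 0) ->
  l2_dot u v = \sum_(x <- Q) dot (u x) (v x).
Proof.
move=> uv0; rewrite /l2_dot !(@sumR_fset Q); last 2 first.
- by move=> x /uv0 ->.
- by move=> x /uv0 ->.
elim: (enum_fset Q) => [|x s IH]; first by rewrite !big_nil.
by rewrite !big_cons -IH; case: (dot _ _).
Qed.

Lemma compressE Q (u : {ffun Q -> V}) : compress H Q u = pQ Q (H (iQ u)).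
Proof. by rewrite /compress lfunE. Qed.

Lemma compress_sym Q (u v : {ffun Q -> V}) :
  ffun_dot (compress H Q u) v = ffun_dot u (compress H Q v).
Proof.
rewrite !compressE; have := Hsym (iQ u) (iQ v).
rewrite !(@l2_dot_fset Q); last 2 first.
- by move=> x xQ; rewrite [iQ u x]ext0_out// dot0l.
- by move=> x xQ; rewrite [iQ v x]ext0_out// dot0r.
rewrite !big_seq_fsetE /= /ffun_dot => h.
under eq_bigr do rewrite ffunE -ext0E.
by under [RHS]eq_bigr do rewrite ffunE -ext0E.
Qed.

(** The matrix element $p_yHi_x$, with source [x] and target [y]; finite range and colour invariance
    are conditions on it. *)
Definition matel x y (v : V) : V := ppt y (H (ipt x v)).

Lemma matel_is_linear x y : linear (matel x y).
Proof.
move=> a u v; rewrite /matel.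
have -> : ipt x (a *: u + v) = a *: ipt x u + ipt x v :> l2 G dot.
  rewrite /ipt -linearP; congr (iQ _); apply/ffunP => z; by rewrite !ffunE.
by rewrite linearP.
Qed.

HB.instance Definition _ x y := GRing.isLinear.Build R[i] V V _ (matel x y)
  (matel_is_linear x y).

Lemma l2_sumE (s : seq G) (F : G -> l2 G dot) y :
  (\sum_(x <- s) F x) y = \sum_(x <- s) F x y.
Proof. by elim: s => [|x s IH]; rewrite ?big_nil// !big_cons -IH. Qed.

Lemma iQ_sum Q (u : {ffun Q -> V}) :
  iQ u = \sum_(x <- Q) ipt x (ext0 u x) :> l2 G dot.
Proof.
apply/val_inj/funext => y.
transitivity (\sum_(x <- Q) (if y == x then ext0 u x else 0)); last first.
  by rewrite -[RHS]/(l2_fun _ y) l2_sumE; apply: eq_bigr => x _; rewrite iptE.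
rewrite -[LHS]/(ext0 u y); have [yQ|yQ] := boolP (y \in Q); last first.
  rewrite ext0_out// big1_fset// => x xQ _.
  by case: eqP => // yx; move: yQ; rewrite yx xQ.
rewrite (big_fsetD1 y)//= eqxx big1_fset ?addr0// => x.
by rewrite !inE eq_sym => /andP[/negbTE ->].
Qed.

Lemma quadratic_form_sum Q (u : {ffun Q -> V}) : ffun_dot (compress H Q u) u =
  \sum_(x <- Q) \sum_(y <- Q) dot (matel x y (ext0 u x)) (ext0 u y).
Proof.
rewrite exchange_big/= /ffun_dot big_seq_fsetE/=; apply: eq_bigr => y _.
rewrite compressE ffunE iQ_sum linear_sum l2_sumE linear_sumlz.
by apply: eq_bigr => x _; rewrite -ext0E.
Qed.

Lemma ffun_dot_sum Q (u : {ffun Q -> V}) :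
  ffun_dot u u = \sum_(x <- Q) dot (ext0 u x) (ext0 u x).
Proof.
by rewrite /ffun_dot big_seq_fsetE/=; apply: eq_bigr => y _; rewrite -ext0E.
Qed.

Definition energy_form Q (E : R) (u : {ffun Q -> V}) : R :=
  complex.Re (ffun_dot (compress H Q u) u) - E * complex.Re (ffun_dot u u).

Lemma dim_ffun Q : \dim {: {ffun Q -> V}} = (#|` Q| * \dim {:V})%N.
Proof. by rewrite !dimvf /dim/= cardfE. Qed.

Lemma eigen_count_spectrum Q : exists ls : seq R,
  size ls = (#|` Q| * \dim {:V})%N /\
  forall E, eigen_count (compress H Q) E = count (fun l => l <= E) ls.
Proof.
have [ls [ss h]] := eigen_countE (@ffun_dotl Q) (@ffun_dotC Q)
  (@ffun_dot_gt0 Q) (@compress_sym Q).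
by exists ls; rewrite ss dim_ffun; split => // E; case: (h E).
Qed.

Lemma eigen_count_split Q E :
  sign_split (@energy_form Q E) (eigen_count (compress H Q) E).
Proof.
have [ls [_ h]] := eigen_countE (@ffun_dotl Q) (@ffun_dotC Q)
  (@ffun_dot_gt0 Q) (@compress_sym Q).
by case: (h E).
Qed.

(** Right translation by [t], cut off to [Q']; nothing is lost when $Qt\subseteq Q'$. *)
Definition shift_fun Q Q' t (u : {ffun Q -> V}) : {ffun Q' -> V} :=
  [ffun y : Q' => ext0 u (val y * t^-1)%g].

Lemma ext0_linear Q a (u v : {ffun Q -> V}) x :
  ext0 (a *: u + v) x = a *: ext0 u x + ext0 v x.
Proof.
by rewrite /ext0; case: insubP => [q _ _|_]; rewrite ?ffunE// scaler0 addr0.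
Qed.

Lemma shift_fun_linear Q Q' t : linear (@shift_fun Q Q' t).
Proof. by move=> a u v; apply/ffunP => x; rewrite !ffunE ext0_linear. Qed.

HB.instance Definition _ Q Q' t := GRing.isLinear.Build R[i] {ffun Q -> V}
  {ffun Q' -> V} _ (@shift_fun Q Q' t) (@shift_fun_linear Q Q' t).

Lemma mem_rtrans Q t x : (x \in rtrans Q t) = ((x * t^-1)%g \in Q).
Proof.
apply/imfsetP/idP => [[y /= yQ ->]|xQ]; first by rewrite mulgK.
by exists (x * t^-1)%g => //=; rewrite mulgVK.
Qed.

Lemma ext0_shift Q Q' t (u : {ffun Q -> V}) x : (rtrans Q t `<=` Q')%fset ->
  ext0 (shift_fun Q' t u) x = ext0 u (x * t^-1)%g.
Proof.
move=> QQ'; have [xQ|xQ] := boolP (x \in Q').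
  by rewrite -[x]/(val [` xQ]%fset) ext0E ffunE.
rewrite !ext0_out//; apply: contra xQ => xQ; apply: (fsubsetP QQ').
by rewrite mem_rtrans.
Qed.

Lemma big_rtrans (W : nmodType) Q Q' t (F : G -> W) : (rtrans Q t `<=` Q')%fset ->
  (forall x, (x * t^-1)%g \notin Q -> F x = 0) ->
  \sum_(x <- Q') F x = \sum_(x <- Q) F (x * t)%g.
Proof.
move=> QQ' F0; rewrite -(big_fset_incl _ QQ'); last first.
  by move=> x _; rewrite mem_rtrans; exact: F0.
by rewrite big_imfset//= => x y _ _; exact: mulIg.
Qed.

(** The shifted function vanishes off $Qt$, so the sums over [Q'] collapse and are reindexed by
    $x\mapsto xt$; invariance of the matrix elements matches the terms. *)
Lemma energy_form_shift Q Q' t E (u : {ffun Q -> V}) :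
  (rtrans Q t `<=` Q')%fset ->
  (forall x y, x \in Q -> y \in Q -> matel (x * t)%g (y * t)%g =1 matel x y) ->
  energy_form E (shift_fun Q' t u) = energy_form E u.
Proof.
move=> QQ' Hinv; rewrite /energy_form !quadratic_form_sum !ffun_dot_sum.
congr (complex.Re _ - _ * complex.Re _); last first.
  rewrite (big_rtrans QQ'); last first.
    by move=> x xQ; rewrite ext0_shift// ext0_out ?dot0l.
  by apply: eq_bigr => x _; rewrite ext0_shift// mulgK.
rewrite (big_rtrans QQ'); last first.
  move=> x xQ; rewrite big1// => y _.
  by rewrite ext0_shift// ext0_out// linear0 dot0l.
rewrite big_seq [RHS]big_seq; apply: eq_bigr => x xQ.
rewrite (big_rtrans QQ'); last first.
  by move=> y yQ; rewrite (ext0_shift _ y)// (ext0_out _ yQ) dot0r.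
rewrite big_seq [RHS]big_seq; apply: eq_bigr => y yQ.
by rewrite !ext0_shift// !mulgK Hinv.
Qed.

Lemma lker_shift Q Q' t : (rtrans Q t `<=` Q')%fset ->
  lker (linfun (@shift_fun Q Q' t)) = 0%VS.
Proof.
move=> QQ'; apply/eqP; rewrite -subv0; apply/subvP => u.
rewrite memv_ker memv0 lfunE => /eqP u0; apply/eqP/ffunP => x.
have := ext0_shift u (val x * t)%g QQ'.
by rewrite mulgK ext0E u0 ffunE => <-; rewrite /ext0; case: insubP => // *; rewrite ffunE.
Qed.

(** The shift is injective and preserves the energy form, so [sign_split_sub] applies. It serves
    inclusions, with [t] equal to 1, and translated copies, with $Q'=Qt$. *)
Lemma eigen_count_shift Q Q' t E :
  (rtrans Q t `<=` Q')%fset ->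
  (forall x y, x \in Q -> y \in Q -> matel (x * t)%g (y * t)%g =1 matel x y) ->
  (eigen_count (compress H Q) E <= eigen_count (compress H Q') E)%N /\
  (eigen_count (compress H Q') E + #|` Q| * \dim {:V} <=
   eigen_count (compress H Q) E + #|` Q'| * \dim {:V})%N.
Proof.
move=> QQ' Hinv; rewrite -!dim_ffun.
apply: sign_split_sub (lker_shift QQ') _ (eigen_count_split Q E)
  (eigen_count_split Q' E).
by move=> u; rewrite lfunE; exact: energy_form_shift.
Qed.

Lemma rtrans1 Q : rtrans Q 1%g = Q.
Proof. by apply/fsetP => x; rewrite mem_rtrans invg1 mulg1. Qed.

Lemma eigen_count_sub Q Q' E : (Q `<=` Q')%fset ->
  (eigen_count (compress H Q) E <= eigen_count (compress H Q') E)%N /\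
  (eigen_count (compress H Q') E + #|` Q| * \dim {:V} <=
   eigen_count (compress H Q) E + #|` Q'| * \dim {:V})%N.
Proof.
move=> QQ'; apply: (@eigen_count_shift _ _ 1%g); first by rewrite rtrans1.
by move=> x y _ _; rewrite !mulg1.
Qed.

Lemma card_rtrans Q t : #|` rtrans Q t| = #|` Q|.
Proof. by rewrite card_imfset//; exact: mulIg. Qed.

Lemma eigen_count_rtrans Q t E :
  (forall x y, x \in Q -> y \in Q -> matel (x * t)%g (y * t)%g =1 matel x y) ->
  eigen_count (compress H (rtrans Q t)) E = eigen_count (compress H Q) E.
Proof.
move=> Hinv; have [] := eigen_count_shift E (fsubset_refl _) Hinv.
by rewrite card_rtrans leq_add2r => h1 h2; apply/anti_leq; rewrite h1 h2.
Qed.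

(** Since the cross matrix elements vanish, the energy form on the union is the sum of the two
    forms, and [sign_split_add] applies to the extensions by zero. *)
Lemma eigen_count_disjU Q1 Q2 E : [disjoint Q1 & Q2]%fset ->
  (forall x y, x \in Q1 -> y \in Q2 -> matel x y =1 (fun=> 0)) ->
  (forall x y, x \in Q2 -> y \in Q1 -> matel x y =1 (fun=> 0)) ->
  eigen_count (compress H (Q1 `|` Q2)%fset) E =
  (eigen_count (compress H Q1) E + eigen_count (compress H Q2) E)%N.
Proof.
move=> dQ H12 H21; set Q := (Q1 `|` Q2)%fset.
have s1 : (rtrans Q1 1%g `<=` Q)%fset by rewrite rtrans1 fsubsetUl.
have s2 : (rtrans Q2 1%g `<=` Q)%fset by rewrite rtrans1 fsubsetUr.
pose e1 := linfun (@shift_fun Q1 Q 1%g); pose e2 := linfun (@shift_fun Q2 Q 1%g).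
have e12 u1 u2 x : ext0 (e1 u1 + e2 u2) x = ext0 u1 x + ext0 u2 x.
  have := ext0_linear 1 (e1 u1) (e2 u2) x; rewrite !scale1r => ->.
  by rewrite !lfunE/= !ext0_shift// !invg1 !mulg1.
have n12 x : x \in Q1 -> x \notin Q2.
  by move=> x1; apply: (fdisjointP dQ).
apply: (sign_split_add (e1 := e1) (e2 := e2) (q1 := @energy_form Q1 E)
  (q2 := @energy_form Q2 E) (q := @energy_form Q E)); last 3 first.
- exact: eigen_count_split.
- exact: eigen_count_split.
- exact: eigen_count_split.
- move=> u1 u2 u0.
  have z x : ext0 u1 x + ext0 u2 x = 0.
    by rewrite -e12 u0 /ext0; case: insubP => // *; rewrite ffunE.
  split; apply/ffunP => x; rewrite ffunE -ext0E; have := z (val x).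
    by rewrite (ext0_out u2) ?addr0// n12// fsvalP.
  rewrite (ext0_out u1) ?add0r//; apply: contraL (fsvalP x); exact: n12.
- move=> u1 u2; rewrite /energy_form !quadratic_form_sum !ffun_dot_sum.
  have sum1 (W : nmodType) (F : G -> W) : (forall x, x \notin Q1 -> F x = 0) ->
      \sum_(x <- Q1) F x = \sum_(x <- Q) F x.
    by move=> F0; apply: big_fset_incl; [exact: fsubsetUl|move=> x _; exact: F0].
  have sum2 (W : nmodType) (F : G -> W) : (forall x, x \notin Q2 -> F x = 0) ->
      \sum_(x <- Q2) F x = \sum_(x <- Q) F x.
    by move=> F0; apply: big_fset_incl; [exact: fsubsetUr|move=> x _; exact: F0].
  have -> : \sum_(x <- Q) dot (ext0 (e1 u1 + e2 u2) x) (ext0 (e1 u1 + e2 u2) x) =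
      \sum_(x <- Q1) dot (ext0 u1 x) (ext0 u1 x) +
      \sum_(x <- Q2) dot (ext0 u2 x) (ext0 u2 x).
    rewrite sum1; last by move=> x x1; rewrite (ext0_out _ x1) dot0l.
    rewrite sum2; last by move=> x x2; rewrite (ext0_out _ x2) dot0l.
    rewrite -big_split/=; apply: eq_bigr => x _; rewrite e12.
    have [x1|x1] := boolP (x \in Q1).
      by rewrite (ext0_out u2) ?n12// dot0l !addr0.
    by rewrite (ext0_out u1)// dot0l !add0r.
  have -> : \sum_(x <- Q) \sum_(y <- Q)
        dot (matel x y (ext0 (e1 u1 + e2 u2) x)) (ext0 (e1 u1 + e2 u2) y) =
      \sum_(x <- Q1) \sum_(y <- Q1) dot (matel x y (ext0 u1 x)) (ext0 u1 y) +
      \sum_(x <- Q2) \sum_(y <- Q2) dot (matel x y (ext0 u2 x)) (ext0 u2 y).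
    rewrite sum1; last first.
      by move=> x x1; rewrite big1// => y _; rewrite (ext0_out u1 x1) linear0 dot0l.
    rewrite [X in _ = _ + X]sum2; last first.
      by move=> x x1; rewrite big1// => y _; rewrite (ext0_out u2 x1) linear0 dot0l.
    rewrite -big_split/=; apply: eq_bigr => x _.
    rewrite sum1; last by move=> y y1; rewrite (ext0_out u1 y1) dot0r.
    rewrite sum2; last by move=> y y1; rewrite (ext0_out u2 y1) dot0r.
    rewrite -big_split/=; apply: eq_bigr => y _; rewrite !e12.
    have m0 : matel x y 0 = 0 by rewrite linear0.
    have [x1|x1] := boolP (x \in Q1); have [y1|y1] := boolP (y \in Q1).
    + by rewrite !(ext0_out u2) ?n12// m0 dot0l !addr0.
    + rewrite (ext0_out u2 (n12 _ x1)) (ext0_out u1 y1) m0 dot0l dot0r !addr0 add0r.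
      by have [y2|y2] := boolP (y \in Q2);
        [rewrite H12 ?dot0l|rewrite (ext0_out u2 y2) dot0r].
    + rewrite (ext0_out u1 x1) (ext0_out u2 (n12 _ y1)) m0 dot0l dot0r !add0r addr0.
      by have [x2|x2] := boolP (x \in Q2);
        [rewrite H21 ?dot0l|rewrite (ext0_out u2 x2) m0 dot0l].
    + by rewrite !(ext0_out u1)// m0 dot0l !add0r.
  rewrite !raddfD/=; ring.
- rewrite /energy_form linear0 /ffun_dot !big1 ?mulr0 ?subrr// => x _;
  by rewrite ffunE dot0r.
- rewrite /energy_form linear0 /ffun_dot !big1 ?mulr0 ?subrr// => x _;
  by rewrite ffunE dot0r.
- by rewrite !dim_ffun -mulnDl cardfsU (eqP dQ) cardfs0 subn0.
Qed.
End Compression.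

(** * Word metric, boundaries and balls *)

Section Words.
Context {G : groupType} (S : {fset G}).
Hypotheses (Ssym : symmetric_gens S) (Sgen : generates S).
Implicit Types (g h x y t : G) (Q : {fset G}).

(** The ball around the unit as an explicit finite set: it gives finiteness and cardinality bounds,
    and distances become membership in it by [wdist_le]. *)
Fixpoint word_ball (L : nat) : {fset G} :=
  if L is L'.+1 then
    (word_ball L' `|` [fset (s * x)%g | s in S, x in word_ball L'])%fset
  else [fset 1%g]%fset.

Lemma word_ballP L g :
  reflect (exists2 L', (L' <= L)%N & is_word S L' g) (g \in word_ball L).
Proof.
apply: (iffP idP) => [|[L' + [s []]]].
  elim: L g => [|L IH] g /=.
    by rewrite inE => /eqP ->; exists 0%N => //; exists [::]; rewrite big_nil.
  rewrite inE => /orP[/IH[L' L'L w]|]; first by exists L' => //; exact: leqW.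
  move=> /imfset2P[a /= aS [x /= /IH[L' L'L [s [ss sS ->]]] ->]].
  exists L'.+1 => //; exists (a :: s); rewrite /= ss big_cons; split => //.
  by move=> b; rewrite in_cons => /orP[/eqP ->//|/sS].
elim: s L L' g => [|a s IH] L L' g L'L /= sL sS ->.
  rewrite big_nil; elim: L {L'L} => [|L IH /=]; first by rewrite inE.
  by rewrite inE IH.
case: L L'L => [|L] L'L; first by rewrite -sL in L'L.
rewrite big_cons /= inE; apply/orP; right; apply/imfset2P.
exists a; first exact/sS/mem_head.
exists (\prod_(b <- s) b)%g => //=.
apply: (IH _ (size s)) => //; first by rewrite -sL in L'L.
by move=> b bs; apply: sS; rewrite in_cons bs orbT.
Qed.

Lemma symmetric_gensV g : g \in S -> (g^-1)%g \in S.
Proof. by move=> gS; rewrite -Ssym; apply/imfsetP; exists g. Qed.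

Lemma is_wordV L g : is_word S L g -> is_word S L g^-1%g.
Proof.
move=> [s [ss sS ->]]; exists [seq (a^-1)%g | a <- rev s]; split.
- by rewrite size_map size_rev.
- by move=> _ /mapP[a + ->]; rewrite mem_rev => /sS; exact: symmetric_gensV.
- by rewrite big_map prodgV revK.
Qed.

Lemma word_ballV L g : g \in word_ball L -> (g^-1)%g \in word_ball L.
Proof.
by move=> /word_ballP[L' L'L w]; apply/word_ballP; exists L' => //; exact: is_wordV.
Qed.

(** Since [S] generates, a minimal length exists, so [xget] never falls back on its default 0. *)
Lemma wdistP g h : is_word S (wdist S g h) (g * h^-1)%g /\
  forall L, is_word S L (g * h^-1)%g -> (wdist S g h <= L)%N.
Proof.
apply: (@xgetPex _ 0%N [set L | is_word S L (g * h^-1)%g /\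
  forall L', is_word S L' (g * h^-1)%g -> (L <= L')%N]); have [L w] := Sgen (g * h^-1)%g.
have ex : exists L, `[< is_word S L (g * h^-1)%g >] by exists L; exact/asboolP.
case: (ex_minnP ex) => m /asboolP mw mmin; exists m; split => // L' /asboolP.
exact: mmin.
Qed.

Lemma wdist_le g h L : (wdist S g h <= L)%N = ((g * h^-1)%g \in word_ball L).
Proof.
have [w wmin] := wdistP g h; apply/idP/word_ballP => [wL|[L' L'L /wmin]].
  by exists (wdist S g h).
by move=> /leq_trans; apply.
Qed.

Lemma wdist_sym g h : wdist S g h = wdist S h g.
Proof.
suff le x y : (wdist S x y <= wdist S y x)%N by apply/anti_leq; rewrite !le.
by rewrite wdist_le -invgF word_ballV// -wdist_le.
Qed.

Lemma wdist_mulr g h t : wdist S (g * t)%g (h * t)%g = wdist S g h.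
Proof. by rewrite /wdist mulgKA. Qed.

(* z is the first point outside Q on the path from x to g x. *)
Lemma word_exit L g Q x : is_word S L g -> x \in Q -> (g * x)%g \notin Q ->
  exists w w' z, [/\ w \in word_ball L, w' \in word_ball L,
    z \in ([fset (s * x)%g | s in S, x in Q] `\` Q)%fset, (g * x = w * z)%g
    & x = (w' * z)%g].
Proof.
move=> [s [<- sS ->]] xQ; elim: s sS => [|a s IH] sS.
  by rewrite big_nil mul1g xQ.
have sS' : {subset s <= S} by move=> b bs; apply: sS; rewrite in_cons bs orbT.
have aS : a \in S by exact/sS/mem_head.
rewrite big_cons /=; set g' := (\prod_(b <- s) b)%g => gx.
have [g'x|g'x] := boolP ((g' * x)%g \in Q).
  exists 1%g, (a * g')^-1%g, (a * g' * x)%g; split.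
  - rewrite -/(word_ball (size s).+1); apply/word_ballP; exists 0%N => //.
    by exists [::]; rewrite big_nil.
  - rewrite -/(word_ball (size s).+1); apply: word_ballV; apply/word_ballP.
    by exists (size s).+1 => //; exists (a :: s); rewrite big_cons.
  - rewrite !inE gx/= -mulgA; apply/imfset2P; exists a => //.
    by exists (g' * x)%g.
  - by rewrite mul1g.
  - by rewrite mulKg.
have [w [w' [z [wL w'L zSQ gE xE]]]] := IH sS' g'x.
exists (a * w)%g, w', z; split => //.
- by rewrite inE; apply/orP; right; apply/imfset2P; exists a => //; exists w.
- by rewrite inE w'L.
- by rewrite -mulgA gE mulgA.
Qed.

Context {R : realType}.
Implicit Types r : R.

(** Holds without finiteness, since [fset_set] is empty on infinite sets. *)
Lemma fset_set_sub_mem (T : choiceType) (X : set T) (a : T) : a \in fset_set X -> X a.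
Proof.
rewrite /fset_set; case: pselect => // fX; case: cid => Y /= -> //.
Qed.

Lemma in_bdry_int r Q x : x \in bdry_int S r Q <->
  x \in Q /\ exists2 y, y \notin Q & (wdist S x y)%:R <= r.
Proof.
split; first exact: fset_set_sub_mem.
move=> h; rewrite in_fset_set ?in_setE//.
by apply: sub_finite_set (finite_fset Q) => y [].
Qed.

Lemma in_shrink r Q x : x \in shrink S r Q <->
  x \in Q /\ forall y, y \notin Q -> r < (wdist S x y)%:R.
Proof.
rewrite /shrink !inE negb_or -andbA; split.
  move=> /and3P[xi _ xQ]; split => // y yQ; rewrite ltNge; apply: contra xi => xy.
  by apply/in_bdry_int; split => //; exists y.
move=> [xQ h]; rewrite xQ andbT; apply/andP; split; apply/negP.
  by move=> /in_bdry_int[_ [y yQ]]; rewrite leNgt h.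
by move=> /fset_set_sub_mem[]; rewrite xQ.
Qed.

Lemma shrink_sub r Q : (shrink S r Q `<=` Q)%fset.
Proof. by apply/fsubsetP => x /in_shrink[]. Qed.

Lemma card_shrink r Q : (#|` shrink S r Q| + #|` bdry_int S r Q|)%N = #|` Q|.
Proof.
have bQ : (bdry_int S r Q `<=` Q)%fset by apply/fsubsetP => x /in_bdry_int[].
rewrite -(cardfsID (bdry_int S r Q) Q) addnC; congr (_ + _)%N.
  by congr (#|` _|); rewrite fsetIC; apply/esym/fsetIidPl.
congr (#|` _|); apply/fsetP => x; apply/idP/idP.
  by rewrite !inE negb_or -andbA => /and3P[-> _ ->].
rewrite !inE negb_or => /andP[-> xQ]; rewrite xQ !andbT/=; apply/negP.
by move=> /fset_set_sub_mem[]; rewrite xQ.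
Qed.

Lemma card_bdry_int_le r Q : (#|` bdry_int S r Q| <= #|` bdry S r Q|)%N.
Proof. exact/fsubset_leq_card/fsubsetUl. Qed.

(** A path of length at most [L] joins each boundary point to the other side of [Q]. It passes
    through some [z] in $SQ\setminus Q$, so the boundary point is a word of length at most [L] times
    [z]. This reduces every radius to the Følner condition. *)
Lemma card_bdry_le r Q L : r <= L%:R -> (#|` bdry S r Q| <=
  #|` word_ball L| * #|` [fset (s * x)%g | s in S, x in Q] `\` Q|%fset)%N.
Proof.
move=> rL; set D := (_ `\` Q)%fset.
pose P := [fset (w * z)%g | w in word_ball L, z in D]%fset.
apply: (@leq_trans #|` P|); last first.
  rewrite -(size_allpairs (fun w z => (w * z)%g) (word_ball L) D).
  apply: uniq_leq_size; first exact: fset_uniq.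
  by move=> _ /imfset2P[w /= wL [z /= zD ->]]; exact: allpairs_f.
have le x y : (wdist S x y)%:R <= r -> is_word S (wdist S x y) (x * y^-1)%g /\
    (wdist S x y <= L)%N.
  move=> xy; split; first by case: (wdistP x y).
  by rewrite -(ler_nat R); exact: le_trans xy rL.
have mono n : (n <= L)%N -> {subset word_ball n <= word_ball L}.
  move=> nL w /word_ballP[m mn ww]; apply/word_ballP; exists m => //.
  exact: leq_trans mn nL.
apply/fsubset_leq_card/fsubsetP => x; rewrite inE => /orP[].
  (* An inner point starts the path and uses [w']; an outer point ends it and uses [w]. *)
  move=> /in_bdry_int[xQ [y yQ]]; rewrite wdist_sym => /le[wyx dL].
  have [|w [w' [z [wL w'L zD _ xE]]]] := word_exit wyx xQ; first by rewrite mulgVK.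
  by apply/imfset2P; exists w'; [exact: mono dL _ w'L|exists z].
move=> /fset_set_sub_mem[xQ [y yQ /le[wxy dL]]].
have [|w [w' [z [wL w'L zD]]]] := word_exit wxy yQ; first by rewrite mulgVK.
rewrite mulgVK => xE _; apply/imfset2P.
by exists w; [exact: mono dL _ wL|exists z].
Qed.

Lemma in_wball r x y : y \in wball S r x <-> (wdist S y x)%:R <= r.
Proof.
split; first exact: fset_set_sub_mem.
move=> h; rewrite in_fset_set ?in_setE//.
apply: (@sub_finite_set _ _ [set` rtrans (word_ball (Num.bound r)) x]); last first.
  exact: finite_fset.
move=> z /= zx; rewrite mem_rtrans.
suff: (wdist S z x <= Num.bound r)%N by rewrite wdist_le.
rewrite -(ler_nat R).
apply: le_trans (zx) _; apply/ltW/archi_boundP.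
exact: le_trans (ler0n _ _) zx.
Qed.

Lemma wdist_diam Q x y : x \in Q -> y \in Q -> (wdist S x y <= diam S Q)%N.
Proof.
move=> xQ yQ; rewrite /diam.
apply: leq_trans (leq_bigmax_cond [` xQ]%fset _) => //=.
exact: (leq_bigmax_cond (F := fun h : Q => wdist S x (val h)) [` yQ]%fset).
Qed.

Lemma shrink_rtrans r Q t : shrink S r (rtrans Q t) = rtrans (shrink S r Q) t.
Proof.
apply/fsetP => x; apply/idP/idP.
  move=> /in_shrink; rewrite mem_rtrans => -[xQ h]; rewrite mem_rtrans.
  apply/in_shrink; split => // y yQ; rewrite -(wdist_mulr _ _ t) mulgVK; apply: h.
  by rewrite mem_rtrans mulgK.
rewrite mem_rtrans => /in_shrink[xQ h]; apply/in_shrink.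
rewrite mem_rtrans; split => // y; rewrite mem_rtrans => /h.
by rewrite wdist_mulr.
Qed.

Lemma wball_rtrans r x t : rtrans (wball S r x) t = wball S r (x * t)%g.
Proof.
apply/fsetP => y; rewrite mem_rtrans; apply/idP/idP.
  by move=> /in_wball; rewrite -(wdist_mulr _ _ t) mulgVK => h; apply/in_wball.
move=> /in_wball h; apply/in_wball.
by rewrite -(wdist_mulr _ _ t) mulgVK.
Qed.
End Words.

(** * Reading patterns as partial maps *)

Section PatternLookup.
Context {G : groupType} {A : finType}.
Implicit Types (C : G -> A) (P : {fmap G -> A}) (Q : {fset G}) (x t : G).

(** Patterns with different domains are compared through the lookup [.[? x]], which avoids
    transporting membership proofs. *)
Lemma fnd_pat_restr C Q x :
  (pat_restr C Q).[? x]%fmap = if x \in Q then Some (C x) else None.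
Proof.
case: ifPn => xQ; last by rewrite not_fnd.
by rewrite (in_fnd (xQ : x \in domf (pat_restr C Q))) ffunE.
Qed.

Lemma fnd_pat_trans P t x : (pat_trans P t).[? x]%fmap = P.[? (x * t^-1)%g]%fmap.
Proof.
have [xP|xP] := boolP (x \in domf (pat_trans P t)).
  rewrite (in_fnd xP) ffunE; have xt := mem_rtransV [` xP]%fset.
  by rewrite (in_fnd xt); congr Some; congr (P _); exact: val_inj.
by rewrite !not_fnd//; apply: contra xP; rewrite -mem_rtrans.
Qed.

Lemma fnd_FinMap Q (f : {ffun Q -> A}) (y : Q) : (FinMap f).[? val y]%fmap = Some (f y).
Proof.
rewrite (in_fnd (fsvalP y : val y \in domf (FinMap f))).
by congr Some; congr (f _); exact: val_inj.
Qed.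
End PatternLookup.

(** * Tilings and pattern counts for an almost additive set function *)

Section Tiling.
Context {G : groupType} (S : {fset G}) {R : realType} (r : R).
Context {A : finType} (C : G -> A) (c : {fset G} -> nat) (d : nat).
Implicit Types (Q U : {fset G}) (x y z : G).
(** [c] abstracts the eigenvalue count at a fixed energy and [d] the dimension of $\mathcal H$; the
    tiling argument sees the operator only through these three hypotheses. *)
Hypothesis c_sub : forall Q Q', (Q `<=` Q')%fset ->
  (c Q <= c Q')%N /\ (c Q' + #|` Q| * d <= c Q + #|` Q'| * d)%N.
Hypothesis c_disjU : forall Q Q', [disjoint Q & Q']%fset ->
  (forall x y, x \in Q -> y \in Q' -> r < (wdist S x y)%:R) ->
  c (Q `|` Q')%fset = (c Q + c Q')%N.
Hypothesis c_rtrans : forall Q t, (forall y, y \in Q -> C (y * t)%g = C y) ->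
  c (shrink S r (rtrans Q t)) = c (shrink S r Q).

Lemma c_fset0 : c fset0 = 0%N.
Proof.
have : c (fset0 `|` fset0)%fset = (c fset0 + c fset0)%N.
  by apply: c_disjU => [|x y]; rewrite ?fdisjoint0X// inE.
by rewrite fsetU0; lia.
Qed.

Lemma c_le Q : (c Q <= #|` Q| * d)%N.
Proof.
by have [_] := c_sub (fsub0set Q); rewrite c_fset0 cardfs0 addn0 add0n.
Qed.

(** A point of one shrunk tile is farther than [r] from everything outside that tile, in particular
    from the other tiles, so [c_disjU] adds them up one by one. *)
Lemma packing_c (Q : {fset G}) (zs : seq G) : uniq zs ->
  {in zs &, forall z z', z != z' -> [disjoint rtrans Q z & rtrans Q z']%fset} ->
  let B := (\bigcup_(z <- zs) shrink S r (rtrans Q z))%fset in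
  c B = (\sum_(z <- zs) c (shrink S r (rtrans Q z)))%N /\
  #|` B| = (size zs * #|` shrink S r Q|)%N.
Proof.
elim: zs => [|z zs IH] /=; first by rewrite !big_nil c_fset0 cardfs0.
move=> /andP[zzs uzs] dis; rewrite !big_cons.
have [|<- sE] := IH uzs.
  by move=> y y' yz y'z; apply: dis; rewrite in_cons ?yz ?y'z orbT.
set B := (\bigcup_(z <- zs) _)%fset in sE *.
have out x y : x \in shrink S r (rtrans Q z) -> y \in B -> y \notin rtrans Q z.
  move=> xz /bigfcupP[z' /andP[z'zs _] /in_shrink[yz' _]].
  have : [disjoint rtrans Q z' & rtrans Q z]%fset.
    apply: dis; rewrite ?mem_head ?in_cons ?z'zs ?orbT//.
    by apply: contraNneq zzs => <-.
  by move/fdisjointP; apply.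
have disj : [disjoint shrink S r (rtrans Q z) & B]%fset.
  apply/fdisjointP => x xz; apply/negP => xB.
  by have := out x x xz xB; move: xz => /in_shrink[->].
split.
  apply: c_disjU => // x y xz yB; move: (xz) => /in_shrink[_]; apply.
  exact: out xz yB.
by rewrite cardfsU (eqP disj) cardfs0 subn0 sE shrink_rtrans card_rtrans.
Qed.

Lemma packing_card (Q : {fset G}) (zs : seq G) : uniq zs ->
  {in zs &, forall z z', z != z' -> [disjoint rtrans Q z & rtrans Q z']%fset} ->
  #|` (\bigcup_(z <- zs) rtrans Q z)%fset| = (size zs * #|` Q|)%N.
Proof.
elim: zs => [|z zs IH] /=; first by rewrite !big_nil cardfs0.
move=> /andP[zzs uzs] dis; rewrite !big_cons.
rewrite cardfsU IH//; last first.
  by move=> y y' yz y'z; apply: dis; rewrite in_cons ?yz ?y'z orbT.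
rewrite (_ : _ `&` _ = fset0)%fset ?cardfs0 ?subn0 ?card_rtrans//.
apply/eqP/fdisjointP => x xz; apply/negP => /bigfcupP[z' /andP[z'zs _] xz'].
have : [disjoint rtrans Q z & rtrans Q z']%fset.
  apply: dis; rewrite ?mem_head ?in_cons ?z'zs ?orbT//.
  by apply: contraNneq zzs => ->.
by move=> /fdisjointP/(_ x xz); rewrite xz'.
Qed.

Variables (Q : {fset G}) (K : set G).
Hypothesis Q_neq0 : Q != fset0.
Hypothesis K_inv : [set (k^-1)%g | k in K] = K.
Hypothesis K_disj : trivIset K (fun g => [set` rtrans Q g]).
Hypothesis K_cover : \bigcup_(g in K) [set` rtrans Q g] = [set: G].

Definition placements U : {fset G} := fset_set [set z | (rtrans Q z `<=` U)%fset].

Lemma in_placements U z : (z \in placements U) = (rtrans Q z `<=` U)%fset.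
Proof.
rewrite /placements in_fset_set; first by apply/idP/idP; rewrite in_setE.
have /fset0Pn[q qQ] := Q_neq0.
apply: sub_finite_set (finite_fset [fset (q^-1 * u)%g | u in U]%fset) => x /= xU.
apply/imfsetP; exists (q * x)%g; rewrite /= ?mulKg//.
by apply: (fsubsetP xU); rewrite mem_rtrans mulgK.
Qed.

Let KV k : K k -> K (k^-1)%g.
Proof. by move=> Kk; rewrite -K_inv; exists k. Qed.

Lemma tile_unique k k' q q' : K k -> K k' -> q \in Q -> q' \in Q ->
  (q * k = q' * k')%g -> k = k'.
Proof.
move=> Kk Kk' qQ q'Q e; apply: (K_disj Kk Kk').
by exists (q * k)%g; split; rewrite /= ?mem_rtrans ?mulgK// e mulgK.
Qed.

(* The part inside U of the tiling obtained by translating the tiling Q K by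
   q^-1. *)
Definition grid U q : {fset G} := [fset z in placements U | `[< K (z * q)%g >]]%fset.

(** The shrunk tiles are separated and lie in the shrunk [U], so they bound [c] from below. The
    upper bound charges [d] for each missed point: the points of [U] in no full tile, which are near
    its boundary, and the inner boundary of each tile. *)
Lemma grid_estimate U q : q \in Q ->
  [/\ (\sum_(z <- grid U q) c (shrink S r (rtrans Q z)) <= c (shrink S r U))%N,
    (c (shrink S r U) <= \sum_(z <- grid U q) c (shrink S r (rtrans Q z)) +
      (#|` bdry_int S ((diam S Q)%:R : R) U| +
       #|` grid U q| * #|` bdry_int S r Q|) * d)%N &
    (#|` grid U q| * #|` Q| <= #|` U|)%N].
Proof.
move=> qQ.
have gridP z : z \in grid U q -> (rtrans Q z `<=` U)%fset /\ K (z * q)%g.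
  by rewrite !inE/= in_placements => /andP[-> /asboolP].
have dis : {in grid U q &, forall z z', z != z' ->
    [disjoint rtrans Q z & rtrans Q z']%fset}.
  move=> z z' /gridP[_ zK] /gridP[_ z'K] zz'; apply/fdisjointP => x.
  rewrite !mem_rtrans => xz; apply/negP => xz'; move/eqP: zz'; apply.
  apply: (@mulIg _ q); apply: (tile_unique zK z'K xz xz').
  by rewrite !mulgA !mulgVK.
have [cB sB] := packing_c (fset_uniq _) dis.
have := packing_card (fset_uniq _) dis.
set T := (\bigcup_(z <- grid U q) rtrans Q z)%fset.
set B := (\bigcup_(z <- _) _)%fset in cB sB * => sT.
have TU : (T `<=` U)%fset.
  by apply/bigfcupsP => z /gridP[zU _] _.
have BU : (B `<=` shrink S r U)%fset.
  apply/bigfcupsP => z /gridP[zU _] _; apply/fsubsetP => x /in_shrink[xz h].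
  apply/in_shrink; split; first exact: (fsubsetP zU).
  by move=> y yU; apply: h; apply: contra yU; exact: (fsubsetP zU).
have UT : (U `\` T `<=` bdry_int S ((diam S Q)%:R : R) U)%fset.
  apply/fsubsetP => u; rewrite inE => /andP[uT uU].
  (* The tile of [u] in the translated tiling is $Qz$ with $zq=k$. As [u] is not covered, $Qz$
     leaves [U] at some point [y], which is within [diam S Q] of [u]. *)
  have : [set: G] (u * q)%g by [].
  rewrite -K_cover => -[k Kk] /=; rewrite mem_rtrans => ukQ.
  pose z := (k * q^-1)%g.
  have uz : u \in rtrans Q z by rewrite mem_rtrans invgF mulgA.
  have zU : ~~ (rtrans Q z `<=` U)%fset.
    apply: contra uT => zU; apply/bigfcupP; exists z => //; rewrite andbT.
    by rewrite !inE/= in_placements zU; apply/asboolP; rewrite mulgVK.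
  have /fsubsetPn[y yz yU] := zU.
  apply/in_bdry_int; split => //; exists y => //; rewrite ler_nat.
  rewrite -(wdist_mulr _ _ _ z^-1%g).
  by apply: wdist_diam; rewrite -mem_rtrans.
have cardU : (#|` U| <= #|` grid U q| * #|` Q| +
    #|` bdry_int S ((diam S Q)%:R : R) U|)%N.
  rewrite -sT -(cardfsID T U) leq_add//; last exact: fsubset_leq_card.
  exact/fsubset_leq_card/fsubsetIr.
have [c1 c2] := c_sub BU.
rewrite -cB; split => //; last by rewrite -sT fsubset_leq_card.
have := card_shrink S r Q; have := card_shrink S r U.
move: cardU c2; rewrite sB.
set g := #|` grid U q|; set bU := #|` bdry_int _ _ U|; set bQ := #|` bdry_int S r Q|.
set sU := #|` shrink S r U|; set sQ := #|` shrink S r Q|.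
set bi := #|` bdry_int S r U| => cardU c2 eU eQ.
have h : (sU <= g * sQ + (bU + g * bQ))%N.
  by move: cardU; rewrite -eQ -eU mulnDr; lia.
by have := leq_mul2r d sU (g * sQ + (bU + g * bQ)); rewrite h orbT mulnDl; lia.
Qed.

(* This is where K = K^-1 enters: writing z^-1 = q k with q in Q and k in K,
   the only q' in Q such that z q' lies in K is q. *)
Lemma sum_grid U (F : G -> nat) :
  (\sum_(q <- Q) \sum_(z <- grid U q) F z)%N = (\sum_(z <- placements U) F z)%N.
Proof.
under eq_bigr do rewrite big_fset/=.
rewrite (exchange_big_dep xpredT)//=; apply: eq_bigr => z _.
have : [set: G] (z^-1)%g by [].
rewrite -K_cover => -[k Kk] /=; rewrite mem_rtrans => zkQ.
rewrite big_mkcond (big_fsetD1 _ zkQ)/= mulVKg asboolT; last exact: KV.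
rewrite big1_fset ?addn0// => q; rewrite !inE => /andP[qn qQ] _.
case: asboolP => // Kzq; exfalso; move/eqP: qn; apply.
have -> : k = (z * q)^-1%g.
  apply: (tile_unique Kk (KV Kzq) zkQ qQ).
  by rewrite mulgVK invgM mulVKg.
by rewrite invgK mulKg.
Qed.

(* A pattern f that does not occur in C gets the value at z = 1; its occurrence
   count is 0. *)
Definition pattern_value (f : {ffun Q -> A}) : nat :=
  c (shrink S r (rtrans Q (xget 1%g [set z | forall y : Q, C (val y * z)%g = f y]))).

Lemma pattern_value_le f : (pattern_value f <= #|` Q| * d)%N.
Proof.
rewrite /pattern_value; set z := xget _ _; apply: leq_trans (c_le _) _.
by rewrite leq_mul2r -(card_rtrans Q z) orbC fsubset_leq_card// shrink_sub.
Qed.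

(** The choice of the occurrence does not matter: translation by $z^{-1}z'$ carries one occurrence
    to the other and preserves colours, so [c_rtrans] applies. *)
Lemma pattern_valueE z :
  c (shrink S r (rtrans Q z)) = pattern_value [ffun y : Q => C (val y * z)%g].
Proof.
rewrite /pattern_value; set P := [set _ | _].
have : P (xget 1%g P).
  by apply: xgetPex; exists z => y; rewrite ffunE.
move: (xget _ _) => z' Pz'.
have -> : rtrans Q z' = rtrans (rtrans Q z) (z^-1 * z')%g.
  by apply/fsetP => x; rewrite !mem_rtrans invgM invgK mulgA mulgK.
apply/esym/c_rtrans => y; rewrite mem_rtrans => yQ.
have := Pz' [` yQ]%fset; rewrite ffunE/= => h.
by rewrite mulgA h mulgVK.
Qed.

Lemma occurrencesE U (f : {ffun Q -> A}) :
  occurrences (FinMap f) (pat_restr C U) =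
  #|` [fset z in placements U | [ffun y : Q => C (val y * z)%g] == f]%fset|.
Proof.
rewrite /occurrences; congr (#|` _|); apply/fsetP => z.
rewrite in_fset_set; last first.
  apply: sub_finite_set (finite_fset (placements U)) => x [/= xU _].
  by rewrite in_placements.
rewrite !inE/= in_placements; apply/idP/andP; rewrite in_setE.
  move=> [zU e]; split => //; apply/eqP/ffunP => y; rewrite ffunE.
  have yz : (val y * z)%g \in rtrans Q z by rewrite mem_rtrans mulgK fsvalP.
  have /fmapP/(_ (val y * z)%g) := e.
  rewrite fnd_restrict yz fnd_pat_restr (fsubsetP zU)// fnd_pat_trans mulgK.
  by rewrite fnd_FinMap => -[].
move=> [zU /eqP fE]; split => //; apply/fmapP => x.
rewrite fnd_restrict fnd_pat_trans fnd_pat_restr.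
case: ifPn => xz; last first.
  by rewrite not_fnd//; move: xz; rewrite mem_rtrans.
rewrite (fsubsetP zU)//; move: (xz); rewrite mem_rtrans => xQ.
by rewrite -[(x * z^-1)%g]/(val [` xQ]%fset) fnd_FinMap -fE ffunE/= mulgVK.
Qed.

(** Sums [grid_estimate] over [q] in [Q] and groups the placements in [U] by the pattern seen
    there. *)
Lemma occurrences_estimate U :
  (\sum_(f : {ffun Q -> A})
     occurrences (FinMap f) (pat_restr C U) * pattern_value f
   <= #|` Q| * c (shrink S r U))%N /\
  (#|` Q| * c (shrink S r U) <= \sum_(f : {ffun Q -> A})
     occurrences (FinMap f) (pat_restr C U) * pattern_value f +
   (#|` Q| * #|` bdry_int S ((diam S Q)%:R : R) U| +
    #|` U| * #|` bdry_int S r Q|) * d)%N.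
Proof.
have -> : (\sum_(f : {ffun Q -> A})
     occurrences (FinMap f) (pat_restr C U) * pattern_value f =
     \sum_(z <- placements U) c (shrink S r (rtrans Q z)))%N.
  rewrite (partition_big (fun z => [ffun y : Q => C (val y * z)%g]) xpredT)//=.
  apply: eq_bigr => f _; rewrite occurrencesE card_fset_sum1 big_fset/= big_distrl/=.
  by apply: eq_bigr => z /eqP zf; rewrite mul1n pattern_valueE zf.
have sumc (X : {fset G}) k : (\sum_(q <- X) k = #|` X| * k)%N.
  by rewrite big_const_seq count_predT iter_addn_0 mulnC.
have card_grid : (\sum_(q <- Q) #|` grid U q| = #|` placements U|)%N.
  rewrite card_fset_sum1 -sum_grid; apply: eq_bigr => q _.
  by rewrite card_fset_sum1.
(* Each grid has at most $|U|/|Q|$ tiles, and there are $|Q|$ grids. *)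
have card_placements : (#|` placements U| <= #|` U|)%N.
  have Q0 : (0 < #|` Q|)%N by rewrite cardfs_gt0.
  rewrite -(leq_pmul2r Q0) -card_grid big_distrl/= [leqRHS]mulnC -sumc.
  by rewrite big_seq [leqRHS]big_seq; apply: leq_sum => q /(grid_estimate U)[].
rewrite -sum_grid -sumc; split.
  by rewrite big_seq [leqRHS]big_seq; apply: leq_sum => q /(grid_estimate U)[].
apply: (@leq_trans (\sum_(q <- Q) (\sum_(z <- grid U q) c (shrink S r (rtrans Q z)) +
      (#|` bdry_int S ((diam S Q)%:R : R) U| +
       #|` grid U q| * #|` bdry_int S r Q|) * d))%N).
  by rewrite big_seq [leqRHS]big_seq; apply: leq_sum => q /(grid_estimate U)[].
rewrite big_split/= leq_add2l -big_distrl/= big_split/= sumc leq_mul2r leq_add2l.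
by rewrite -big_distrl/= card_grid leq_mul2r card_placements !orbT.
Qed.
End Tiling.

(** * Eigenvalue counts against pattern means *)

Section Operator.
Context {R : realType} {G : groupType} {S : {fset G}} {A : finType} {C : G -> A}.
Context {V : vectType R[i]} {dot : {dot V for Num.conj}}.
Context {H : {linear l2 G dot -> l2 G dot}} {M r : R} {N : nat}.
Hypotheses (Ssym : symmetric_gens S) (Sgen : generates S).
Hypotheses (Hsym : selfadjoint H) (Hrange : finite_range S H M).
Hypotheses (HC : colour_invariant C S H N) (Mr : M <= r) (Nr : N%:R <= r).
Implicit Types (Q U : {fset G}) (E : R).

Local Notation c E := (fun Q => eigen_count (compress H Q) E).

Lemma eigen_count_far E Q Q' : [disjoint Q & Q']%fset ->
  (forall x y, x \in Q -> y \in Q' -> r < (wdist S x y)%:R) ->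
  c E (Q `|` Q')%fset = (c E Q + c E Q')%N.
Proof.
move=> QQ' far; apply: eigen_count_disjU => // x y xQ yQ v.
  by apply: Hrange; apply: le_trans Mr _; apply/ltW/far.
apply: Hrange; apply: le_trans Mr _.
by rewrite (wdist_sym Ssym Sgen); apply/ltW/far.
Qed.

(** Balls of radius [N] around points of the shrunk set stay in [Q], because [N] is at most [r].
    There the colours agree with their translates, so colour invariance equates the matrix
    elements. *)
Lemma eigen_count_pattern E Q t : (forall y, y \in Q -> C (y * t)%g = C y) ->
  c E (shrink S r (rtrans Q t)) = c E (shrink S r Q).
Proof.
move=> Ct; rewrite shrink_rtrans; apply: eigen_count_rtrans => // x y xQ yQ v.
apply/esym/HC/fmapP => u; rewrite fnd_pat_trans !fnd_pat_restr.
have ballE w : ((u * t^-1)%g \in wball S (N%:R : R) w) =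
    (u \in wball S (N%:R : R) (w * t)%g).
  by rewrite -mem_rtrans (wball_rtrans Sgen).
rewrite !inE !ballE; case: ifPn => // uB; congr Some.
have : (u * t^-1)%g \in Q; last by move=> /Ct; rewrite mulgVK.
have ballQ w : w \in shrink S r Q -> u \in wball S (N%:R : R) (w * t)%g ->
    (u * t^-1)%g \in Q.
  rewrite -ballE => /in_shrink[_ h] /(in_wball Sgen) uw.
  apply: contraT => /h; rewrite (wdist_sym Ssym Sgen) ltNge.
  by rewrite (le_trans uw Nr).
by case/orP: uB; apply: ballQ.
Qed.

Definition pattern_mean (Q : {fset G}) (E : R) (w : {ffun Q -> A} -> R) : R :=
  \sum_(f : {ffun Q -> A}) w f *
    ((pattern_value S r C (c E) f)%:R / (#|` Q|%:R * (\dim {:V})%:R)).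

Hypothesis V_gt0 : (0 < \dim {:V})%N.

(** Each normalized pattern value lies in $[0,1]$ by [pattern_value_le]. *)
Lemma pattern_mean_dist (Q : {fset G}) E (w w' : {ffun Q -> A} -> R) : Q != fset0 ->
  `|pattern_mean E w - pattern_mean E w'| <= \sum_f `|w f - w' f|.
Proof.
move=> Q0; rewrite /pattern_mean -sumrB; apply: le_trans (ler_norm_sum _ _ _) _.
apply: ler_sum => f _; rewrite -mulrBl normrM ler_piMr//.
have QV : 0 < #|` Q|%:R * (\dim {:V})%:R :> R.
  by rewrite mulr_gt0 ?ltr0n ?cardfs_gt0.
rewrite ger0_norm ?divr_ge0 ?mulr_ge0// ler_pdivrMr// mul1r -natrM ler_nat.
apply: pattern_value_le => Q1 Q2; first exact: eigen_count_sub.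
exact: eigen_count_far.
Qed.

(** This is [occurrences_estimate] divided by $|U||Q|\dim V$; its lower bound makes the difference
    nonnegative, which removes the absolute value. *)
Lemma pattern_mean_estimate (Q U : {fset G}) E :
  symmetrically_tiles Q -> Q != fset0 -> U != fset0 ->
  `|(c E (shrink S r U))%:R / ((\dim {:V})%:R * #|` U|%:R) -
    pattern_mean E (fun f : {ffun Q -> A} => pat_ratio R C U (FinMap f))| <=
  #|` bdry_int S r Q|%:R / #|` Q|%:R +
  #|` bdry_int S ((diam S Q)%:R : R) U|%:R / #|` U|%:R.
Proof.
move=> [K [Ki Kd Kc]] Q0 U0.
have [lo up] := occurrences_estimate
  (fun Q Q' => @eigen_count_sub _ _ _ _ _ Hsym Q Q' E)
  (@eigen_count_far E) (@eigen_count_pattern E) Q0 Ki Kd Kc U.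
rewrite /pattern_mean /pat_ratio.
set s := (\sum_f _)%N in lo up.
set n := #|` Q| in lo up *; set u := #|` U| in up *.
have n0 : n%:R != 0 :> R by rewrite pnatr_eq0 cardfs_eq0.
have u0 : u%:R != 0 :> R by rewrite pnatr_eq0 cardfs_eq0.
have d0 : (\dim {:V})%:R != 0 :> R by rewrite pnatr_eq0 -lt0n.
have -> : \sum_(f : {ffun Q -> A})
    (occurrences (FinMap f) (pat_restr C U))%:R / u%:R *
    ((pattern_value S r C (c E) f)%:R / (n%:R * (\dim {:V})%:R)) =
    s%:R / (u%:R * n%:R * (\dim {:V})%:R) :> R.
  rewrite natr_sum mulr_suml; apply: eq_bigr => f _; rewrite natrM; field.
  by rewrite n0 u0 d0.
move: lo up; rewrite -!(ler_nat R) !(natrD, natrM).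
set k := (eigen_count _ E)%:R; set bU := #|` bdry_int S _ U|%:R.
set bQ := #|` bdry_int S r Q|%:R => lo up.
have -> : k / ((\dim {:V})%:R * u%:R) - s%:R / (u%:R * n%:R * (\dim {:V})%:R) =
    (n%:R * k - s%:R) / (u%:R * n%:R * (\dim {:V})%:R).
  by field; rewrite n0 u0 d0.
have -> : bQ / n%:R + bU / u%:R =
    (n%:R * bU + u%:R * bQ) * (\dim {:V})%:R / (u%:R * n%:R * (\dim {:V})%:R).
  by field; rewrite n0 u0 d0.
rewrite ger0_norm ?divr_ge0 ?mulr_ge0 ?subr_ge0//.
by rewrite ler_wpM2r ?invr_ge0 ?mulr_ge0// lerBlDl.
Qed.
End Operator.

(** * Distribution functions as uniform limits of counting functions *)

Section CountLimits.
Context {R : realType}.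
Implicit Types (ls : seq R) (E : R).

Lemma count_le_right ls E : exists2 e : R, 0 < e &
  forall E', E <= E' < E + e -> count (fun l => l <= E') ls = count (fun l => l <= E) ls.
Proof.
elim: ls => [|l ls [e e0 IH]]; first by exists 1.
have [lE|El] := leP l E.
  exists e => // E' /andP[EE' E'e] /=.
  by rewrite IH ?EE'// lE (le_trans lE EE').
exists (Num.min e (l - E)); first by rewrite lt_min e0 subr_gt0.
move=> E' /andP[EE']; rewrite -ltrBlDl lt_min !ltrBlDl => /andP[E'e E'l] /=.
rewrite IH ?EE'//; move: E'l; rewrite addrC subrK => E'l.
by rewrite !leNgt El E'l.
Qed.

Lemma count_le_low ls : exists m : R, forall E, E < m ->
  count (fun l => l <= E) ls = 0%N.
Proof.
elim: ls => [|l ls [m IH]]; first by exists 0.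
exists (Num.min l m) => E; rewrite lt_min => /andP[El Em] /=.
by rewrite IH// leNgt El.
Qed.

Lemma count_le_high ls : exists m : R, forall E, m < E ->
  count (fun l => l <= E) ls = size ls.
Proof.
elim: ls => [|l ls [m IH]]; first by exists 0.
exists (Num.max l m) => E; rewrite gt_max => /andP[El Em] /=.
by rewrite IH// ltW.
Qed.

Lemma count_le_mono ls E E' : E <= E' ->
  (count (fun l => (l <= E)%R) ls <= count (fun l => (l <= E')%R) ls)%N.
Proof. by move=> EE'; apply: sub_count => l /= /le_trans; apply. Qed.

(** Normalized counts of finite lists are monotone step functions, constant just to the right of
    each point, running from 0 to 1; these properties survive uniform approximation. Comparing two
    points spends half of [e] at each. *)
Lemma uniform_limit_cumulative (F : R -> R) :
  (forall e, 0 < e -> exists2 ls : seq R, (0 < size ls)%N &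
     forall E, `|(count (fun l => l <= E) ls)%:R / (size ls)%:R - F E| <= e) ->
  [/\ nondecreasing F, right_continuous F, F @ -oo --> (0 : R) & F @ +oo --> (1 : R)].
Proof.
move=> h; split.
- move=> x y xy; apply/ler_addgt0Pl => e e0.
  have [ls ls0 lsF] := h (e / 2) ltac:(by rewrite divr_gt0).
  have := lsF x; have := lsF y; rewrite !ler_distl => /andP[h1 h2] /andP[h3 h4].
  have : (count (fun l => l <= x) ls)%:R / (size ls)%:R <=
      (count (fun l => l <= y) ls)%:R / (size ls)%:R :> R.
    by rewrite ler_pM2r ?invr_gt0 ?ltr0n// ler_nat count_le_mono.
  lra.
- move=> x; apply/cvgrPdist_le => e e0.
  have [ls ls0 lsF] := h (e / 2) ltac:(by rewrite divr_gt0).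
  have [d d0 hd] := count_le_right ls x.
  near=> y.
  have := lsF x; have := lsF y; rewrite hd; last first.
    apply/andP; split; [apply: ltW|]; near: y; first exact: nbhs_right_gt.
    by apply: nbhs_right_lt; rewrite ltrDl.
  rewrite !ler_distl => /andP[h1 h2] /andP[h3 h4]; apply/andP; split; lra.
- apply/cvgrPdist_le => e e0.
  have [ls ls0 lsF] := h e e0; have [m hm] := count_le_low ls.
  near=> y; have := lsF y; rewrite hm ?mul0r//.
  by near: y; apply: nbhs_ninfty_lt; rewrite num_real.
- apply/cvgrPdist_le => e e0.
  have [ls ls0 lsF] := h e e0; have [m hm] := count_le_high ls.
  near=> y; have := lsF y; rewrite hm ?divff//; first by rewrite pnatr_eq0 -lt0n.
  by near: y; apply: nbhs_pinfty_gt; rewrite num_real.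
Unshelve. all: by end_near. Qed.

Lemma distribution_functionE (mu : probability (measurableTypeR R) R) E :
  mu `]-oo, E]%classic = (distribution_function mu E)%:E.
Proof.
by rewrite /distribution_function set_itvE fineK// fin_num_measure//= -set_itvE.
Qed.

(** Both measures give $]a,b]$ the difference of two values of the distribution function, and these
    intervals determine the measure. *)
Lemma lebesgue_stieltjes_of_distribution (f : cumulativeBounded (0 : R) (1 : R))
    (mu : probability (measurableTypeR R) R) : distribution_function mu =1 f ->
  forall B : set (measurableTypeR R), measurable B ->
    lebesgue_stieltjes_measure f B = mu B.
Proof.
move=> muf B mB; apply: lebesgue_stieltjes_measure_unique mB => _ [[a b]]/= _ <-.
rewrite /lebesgue_stieltjes_measure /measure_extension/=.
rewrite measurable_mu_extE/=; last exact: is_ocitv.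
have [ab|ba] := leP a b; last first.
  by rewrite set_itv_ge ?wlength0 ?measure0// bnd_simp -leNgt ltW.
rewrite wlength_itv_bnd// -!muf EFinB -!distribution_functionE.
have : `]a, b]%classic = `]-oo, b] `\` `]-oo, a] => [|->].
  by rewrite -[RHS]setCK setCD setCitvl setUC -[LHS]setCK setCitv.
rewrite measureD ?setIidr//; first exact: subset_itvl.
by rewrite -ge0_fin_numE// fin_num_measure.
Qed.

Lemma cumulative_limit_probability (F : R -> R) :
  [/\ nondecreasing F, right_continuous F, F @ -oo --> (0 : R) & F @ +oo --> (1 : R)] ->
  exists mu : probability (measurableTypeR R) R,
    distribution_function mu =1 F /\
    forall mu' : probability (measurableTypeR R) R, distribution_function mu' =1 F ->
      forall B : set (measurableTypeR R), measurable B -> mu' B = mu B.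
Proof.
move=> [Fnd Frc FN Fy].
pose f : cumulativeBounded (0 : R) (1 : R) := HB.pack F
  (isCumulative.Build R _ R F Fnd Frc) (isCumulativeBounded.Build R 0 1 F FN Fy).
exists (lebesgue_stieltjes_measure f); split; last first.
  by move=> mu' mu'F B mB; rewrite -(@lebesgue_stieltjes_of_distribution f).
move=> E; rewrite /distribution_function.
have := cdf_lebesgue_stieltjes_id f E.
rewrite /cdf /distribution /pushforward preimage_id.
by rewrite set_itvE => ->.
Qed.
End CountLimits.

(** * Common points and vanishing errors along Følner sequences *)

Section Limits.
Context {R : realType}.

(** The same [x j] is close to both [l m] and [l n]; letting [j] grow removes the terms [b], so the
    intervals of radii [a m] and [a n] meet. *)
Lemma limit_of_estimates (a : nat -> R) (b : nat -> nat -> R) (l x : nat -> R) :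
  (forall j n, `|x j - l n| <= a n + b j n) ->
  (forall n, b ^~ n @ \oo --> 0) ->
  exists y, forall n, `|l n - y| <= a n.
Proof.
move=> xl b0.
have lle m n : l m - a m <= l n + a n.
  apply/ler_addgt0Pl => e e0.
  have e2 : 0 < e / 2 by rewrite divr_gt0.
  have [j [bm bn]] : exists j, `|b j m| <= e / 2 /\ `|b j n| <= e / 2.
    have : \forall j \near \oo, `|b j m| <= e / 2 /\ `|b j n| <= e / 2.
      near=> j; split; near: j.
        by have /cvgr0Pnorm_le := b0 m; apply.
      by have /cvgr0Pnorm_le := b0 n; apply.
    by move=> /filter_ex.
  have := xl j m; have := xl j n; rewrite !ler_distl => /andP[h1 h2] /andP[h3 h4].
  have := ler_norm (b j m); have := ler_norm (b j n); lra.
(* The intervals [l n - a n, l n + a n] pairwise meet, hence have a common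
   point. *)
pose X := [set l n + a n | n in [set: nat]].
exists (inf X) => n; rewrite ler_distl; apply/andP; split.
  rewrite lerBlDr; apply: ge_inf; last by exists n.
  by exists (l 0%N - a 0%N) => _ [m _ <-].
rewrite -lerBlDr; apply: lb_le_inf; first by exists (l 0%N + a 0%N), 0%N.
by move=> _ [m _ <-].
Unshelve. all: by end_near. Qed.

Lemma cvgD0 (f g : nat -> R) : f @ \oo --> 0 -> g @ \oo --> 0 ->
  (fun j => f j + g j) @ \oo --> 0.
Proof. by move=> f0 g0; rewrite -(addr0 0); apply: (cvgD f0 g0). Qed.

Lemma cvgM0 (k : R) (f : nat -> R) : f @ \oo --> 0 -> (fun j => k * f j) @ \oo --> 0.
Proof. by move=> f0; rewrite -(mulr0 k); apply: cvgMl_tmp f0. Qed.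

Lemma cvg_sum0 (T : Type) (s : seq T) (F : T -> nat -> R) :
  (forall i, F i @ \oo --> 0) -> (fun j => \sum_(i <- s) F i j) @ \oo --> 0.
Proof.
move=> F0; elim: s => [|i s IH].
  by under eq_fun do rewrite big_nil; exact: cvg_cst.
under eq_fun do rewrite big_cons.
exact: cvgD0.
Qed.

Lemma supnorm_le (F : R -> R) (x : R) :
  (supnorm F <= x%:E)%E <-> forall E, `|F E| <= x.
Proof.
split=> [Fx E|Fx].
  by rewrite -lee_fin; apply: le_trans Fx; apply: ereal_sup_ubound; exists E.
by apply: ge_ereal_sup => _ [E _ <-]; rewrite lee_fin.
Qed.

Lemma supnorm_ge0 (F : R -> R) : (0 <= supnorm F)%E.
Proof.
apply: (@le_trans _ _ `|F 0|%:E); first by rewrite lee_fin.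
by apply: ereal_sup_ubound; exists 0.
Qed.

Lemma cvg_supnorm0 (F : nat -> R -> R) :
  (forall e, 0 < e -> \forall j \near \oo, forall E, `|F j E| <= e) ->
  (fun j => supnorm (F j)) @ \oo --> 0%E.
Proof.
move=> F0; apply/fine_cvgP; split.
  near=> j; rewrite ge0_fin_numE ?supnorm_ge0//.
  apply: (@le_lt_trans _ _ 1%:E); last exact: ltry.
  by apply/supnorm_le; near: j; exact: F0.
apply/cvgr0Pnorm_le => e e0; near=> j.
have Fe : (supnorm (F j) <= e%:E)%E by apply/supnorm_le; near: j; exact: F0.
rewrite /= ger0_norm; last by rewrite fine_ge0// supnorm_ge0.
rewrite -lee_fin fineK// ge0_fin_numE ?supnorm_ge0//.
exact: le_lt_trans Fe (ltry _).
Unshelve. all: by end_near. Qed.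

Context {G : groupType} {S : {fset G}}.
Hypotheses (Ssym : symmetric_gens S) (Sgen : generates S).

(** By [card_bdry_le] the boundary is at most a constant, the size of [word_ball S L], times
    $|SQ_n\setminus Q_n|$. *)
Lemma folner_bdry (Q : nat -> {fset G}) (r : R) : folner R S Q ->
  (fun n => #|` bdry S r (Q n)|%:R / #|` Q n|%:R : R) @ \oo --> (0 : R).
Proof.
move=> [_ FQ]; pose L := Num.bound r.
have rL : r <= L%:R.
  have [r0|r0] := leP 0 r; first exact/ltW/archi_boundP.
  by apply: le_trans (ltW r0) _; rewrite ler0n.
apply: (@squeeze_cvgr _ _ _ _ (fun=> 0) (fun n => #|` word_ball S L|%:R *
  (#|` [fset (s * x)%g | s in S, x in Q n] `\` Q n|%fset%:R / #|` Q n|%:R))).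
- apply: nearW => n; rewrite divr_ge0//= mulrA ler_wpM2r ?invr_ge0//.
  by rewrite -natrM ler_nat; exact: (card_bdry_le Ssym Sgen _ rL).
- exact: cvg_cst.
- exact: cvgM0.
Qed.

Lemma folner_bdry_int (Q : nat -> {fset G}) (r : R) : folner R S Q ->
  (fun n => #|` bdry_int S r (Q n)|%:R / #|` Q n|%:R : R) @ \oo --> (0 : R).
Proof.
move=> /(@folner_bdry Q r) FQ.
apply: squeeze_cvgr (cvg_cst 0) FQ; apply: nearW => n.
by rewrite divr_ge0//= ler_wpM2r ?invr_ge0// ler_nat card_bdry_int_le.
Qed.

Context {A : finType} (C : G -> A) (Q U : nat -> {fset G}) (r : R).
Hypotheses (FQ : folner R S Q) (FU : folner R S U).
Hypothesis freq : forall P : {fmap G -> A}, (exists n, domf P = Q n) ->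
  cvgn (fun j => pat_ratio R C (U j) P).

(** The part of the error that vanishes in [j] with [n] fixed, while counts are still divided by
    $|U_j|$. *)
Definition sampling_error (j n : nat) : R :=
  #|` bdry_int S ((diam S (Q n))%:R : R) (U j)|%:R / #|` U j|%:R +
  \sum_(f : {ffun Q n -> A})
    `|pat_ratio R C (U j) (FinMap f) - frequency R C U (FinMap f)|.

Lemma frequency_dev0 n :
  (fun j => \sum_(f : {ffun Q n -> A})
    `|pat_ratio R C (U j) (FinMap f) - frequency R C U (FinMap f)|) @ \oo --> (0 : R).
Proof.
apply: cvg_sum0 => f; have : (fun j => pat_ratio R C (U j) (FinMap f)) @ \oo -->
    frequency R C U (FinMap f) by apply: freq; exists n.
move=> /cvgrPdist_le h; apply/cvgr0Pnorm_le => e /h; apply: filterS => j.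
by rewrite normr_id distrC.
Qed.

Lemma sampling_error0 n : sampling_error ^~ n @ \oo --> (0 : R).
Proof.
exact: cvgD0 (folner_bdry_int _ FU) (frequency_dev0 n).
Qed.

(** The argument yields inner boundaries with constants 2 and 1; passing to full boundaries and to
    the constants 8 and $1+4|B_R|$ enlarges the bound. *)
Lemma ids_error_ge j n : 2 * (#|` bdry_int S r (Q n)|%:R / #|` Q n|%:R) +
  sampling_error j n + #|` bdry_int S r (U j)|%:R / #|` U j|%:R <=
  ids_error S C Q U r j n.
Proof.
have bi (T : {fset G}) (t : R) : 0 <= #|` bdry_int S t T|%:R / #|` T|%:R :> R /\
    #|` bdry_int S t T|%:R / #|` T|%:R <= #|` bdry S t T|%:R / #|` T|%:R :> R.
  by rewrite divr_ge0// ler_wpM2r ?invr_ge0// ler_nat card_bdry_int_le.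
rewrite /ids_error /sampling_error.
have [h1 h2] := bi (Q n) r; have [h3 h4] := bi (U j) (diam S (Q n))%:R.
have B0 : 0 <= #|` wball S r 1%g|%:R :> R by [].
have := mulr_ge0 B0 (le_trans h3 h4).
set B := #|` wball _ _ _|%:R; set x := _ / #|` Q n|%:R.
move: h1 h2 h3 h4; rewrite -/x; lra.
Qed.

(** First [n] is fixed to make the boundary term of [Q n] small, as that term does not depend on
    [j]; then [j] tends to infinity. *)
Lemma ids_error_small e : 0 < e -> exists n, \forall j \near \oo,
  shrink S r (U j) != fset0 /\ ids_error S C Q U r j n <= e.
Proof.
move=> e0.
(* The factor 8 turns $e/16$ into half of the allowed error. *)
have [n hn] : exists n, `|#|` bdry S r (Q n)|%:R / #|` Q n|%:R : R| <= e / 16.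
  have /cvgr0Pnorm_le/(_ (e / 16)) := @folner_bdry Q r FQ.
  by rewrite divr_gt0// => /(_ isT)/filter_ex.
exists n; near=> j; split.
  (* If the shrunk set were empty, the inner boundary would be all of [U j], with ratio 1 instead of
     at most 1/2. *)
  have : `|#|` bdry_int S r (U j)|%:R / #|` U j|%:R : R| <= 2^-1.
    by near: j; have /cvgr0Pnorm_le := @folner_bdry_int U r FU; apply.
  apply: contraTneq => s0; have := card_shrink S r (U j); rewrite s0 cardfs0 add0n => ->.
  rewrite divff ?normr1; last by rewrite pnatr_eq0 cardfs_eq0; case: FU.
  by rewrite -ltNge invf_lt1 ?ltr1n.
have : ids_error S C Q U r j n - 8 * (#|` bdry S r (Q n)|%:R / #|` Q n|%:R) <= e / 2.
  apply: le_trans (ler_norm _) _; near: j.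
  have : (fun j => ids_error S C Q U r j n -
      8 * (#|` bdry S r (Q n)|%:R / #|` Q n|%:R)) @ \oo --> (0 : R).
    rewrite [X in X @ _](_ : _ = fun j => (1 + 4 * #|` wball S r 1%g|%:R) *
        (#|` bdry S ((diam S (Q n))%:R : R) (U j)|%:R / #|` U j|%:R) +
      \sum_(f : {ffun Q n -> A})
        `|pat_ratio R C (U j) (FinMap f) - frequency R C U (FinMap f)| +
      #|` bdry_int S r (U j)|%:R / #|` U j|%:R); last first.
      by apply/funext => j; rewrite /ids_error; ring.
    apply: cvgD0; last exact: folner_bdry_int.
    apply: cvgD0; last exact: frequency_dev0.
    by apply: cvgM0; exact: folner_bdry.
  by move=> /cvgr0Pnorm_le; apply; rewrite divr_gt0.
have := ler_norm (#|` bdry S r (Q n)|%:R / #|` Q n|%:R : R); lra.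
Unshelve. all: by end_near. Qed.
End Limits.

(** * Existence, uniqueness and uniform convergence of the integrated density of states *)

Theorem theorem4p5 (R : realType) (G : groupType) (S : {fset G})
    (A : finType) (C : G -> A) (Q U : nat -> {fset G})
    (V : vectType R[i]) (dot : {dot V for Num.conj})
    (H : {linear l2 G dot -> l2 G dot}) (M : R) (N : nat) :
  symmetric_gens S -> generates S -> amenable R S ->
  folner R S Q -> (forall n, symmetrically_tiles (Q n)) ->
  folner R S U ->
  (forall P : {fmap G -> A}, (exists n, domf P = Q n) ->
     cvgn (fun j => pat_ratio R C (U j) P)) ->
  (0 < \dim {:V})%N ->
  selfadjoint H ->
  0 < M -> finite_range S H M ->
  colour_invariant C S H N ->
  let r : R := Num.max M N%:R in
  let deviation (mu : probability (measurableTypeR R) R) (j : nat) : \bar R :=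
    supnorm (fun E => normalized_count H (shrink S r (U j)) E
                      - distribution_function mu E) in
  let estimate (mu : probability (measurableTypeR R) R) : Prop :=
    forall j n, shrink S r (U j) != fset0 ->
      (deviation mu j <= (ids_error S C Q U r j n)%:E)%E in
  exists mu : probability (measurableTypeR R) R,
    [/\ estimate mu,
        forall mu' : probability (measurableTypeR R) R, estimate mu' ->
          forall B : set (measurableTypeR R), measurable B -> mu' B = mu B
      & deviation mu @ \oo --> 0%E].
Proof.
move=> Ssym Sgen _ FQ Qtiles FU freq V0 Hsym M0 Hrange HC r deviation estimate.
have Mr : M <= r by rewrite le_max lexx.
have Nr : N%:R <= r by rewrite le_max lexx orbT.
have Q0 n : Q n != fset0 by case: FQ.
have U0 j : U j != fset0 by case: FU.
pose d : R := (\dim {:V})%:R.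
have d0 : 0 < d by rewrite ltr0n.
pose c j E : R := (eigen_count (compress H (shrink S r (U j))) E)%:R.
pose L n E := pattern_mean (S := S) (r := r) (C := C) (H := H) E
  (fun f : {ffun Q n -> A} => frequency R C U (FinMap f)).
have fL E j n : `|c j E / (d * #|` U j|%:R) - L n E| <=
    #|` bdry_int S r (Q n)|%:R / #|` Q n|%:R + sampling_error (S := S) C Q U j n.
  have h1 := pattern_mean_estimate Ssym Sgen Hsym Hrange HC Mr Nr V0 E
    (Qtiles n) (Q0 n) (U0 j).
  have h2 := pattern_mean_dist Ssym Sgen Hsym Hrange Mr V0 E
    (fun f : {ffun Q n -> A} => pat_ratio R C (U j) (FinMap f))
    (fun f : {ffun Q n -> A} => frequency R C U (FinMap f)) (Q0 n).
  (* The mean weighted by the pattern ratios in [U j] is the intermediate term. *)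
  rewrite -(subrKA (pattern_mean (S := S) (r := r) (C := C) (H := H) E
    (fun f : {ffun Q n -> A} => pat_ratio R C (U j) (FinMap f)))).
  by apply: le_trans (ler_normD _ _) _; rewrite /sampling_error addrA lerD.
(* [F E] is chosen for each energy separately; the bound does not depend on [E], so the closeness is
   uniform. *)
have /choice[F FL] : forall E, exists y, forall n,
    `|L n E - y| <= #|` bdry_int S r (Q n)|%:R / #|` Q n|%:R.
  by move=> E; apply: limit_of_estimates (fL E) _ => n; exact: sampling_error0.
have gF j n E : shrink S r (U j) != fset0 ->
    `|normalized_count H (shrink S r (U j)) E - F E| <= ids_error S C Q U r j n.
  move=> sU; apply: le_trans (@ids_error_ge _ _ S _ C Q U r j n).
  have sU0 : #|` shrink S r (U j)|%:R != 0 :> R by rewrite pnatr_eq0 cardfs_eq0.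
  have uU0 : #|` U j|%:R != 0 :> R by rewrite pnatr_eq0 cardfs_eq0.
  (* Passing from $|U_j|$ to $|U_{j,R}|$ costs the inner boundary ratio times a factor at most 1,
     since there are $|U_{j,R}|\dim V$ eigenvalues in all. *)
  have gf : `|normalized_count H (shrink S r (U j)) E - c j E / (d * #|` U j|%:R)| <=
      #|` bdry_int S r (U j)|%:R / #|` U j|%:R.
    have cle : c j E <= #|` shrink S r (U j)|%:R * d.
      have [ls [ss /(_ E) cE]] := eigen_count_spectrum Hsym (shrink S r (U j)).
      by rewrite /c cE -natrM ler_nat -ss count_size.
    have -> : normalized_count H (shrink S r (U j)) E - c j E / (d * #|` U j|%:R) =
        c j E / (#|` shrink S r (U j)|%:R * d) *
        (#|` bdry_int S r (U j)|%:R / #|` U j|%:R).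
      have /(congr1 (fun k => k%:R : R)) := card_shrink S r (U j).
      rewrite natrD -/(c j E) /normalized_count -/d -/(c j E) => cs.
      rewrite -(addKr (#|` shrink S r (U j)|%:R) (#|` bdry_int S r (U j)|%:R)) cs.
      by field; rewrite sU0 uU0 gt_eqF.
    rewrite ger0_norm; last by rewrite !mulr_ge0 ?invr_ge0 ?mulr_ge0 ?ler0n.
    rewrite ler_piMl ?divr_ge0// ler_pdivrMr ?mul1r//.
    by rewrite mulr_gt0// lt0r sU0 ler0n.
  (* Three distances add up: the change of normalization, [fL] and [FL]. The last two each
     contribute the boundary of [Q n], whence the factor 2 in [ids_error_ge]. *)
  have := fL E j n; have := FL E n; move: gf.
  rewrite !ler_distl.
  move=> /andP[h1 h2] /andP[h3 h4] /andP[h5 h6]; apply/andP; split; lra.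
have small e : 0 < e -> exists n, \forall j \near \oo,
    shrink S r (U j) != fset0 /\ ids_error S C Q U r j n <= e.
  exact: ids_error_small.
have [|mu [muF mu_uniq]] := @cumulative_limit_probability R F.
  apply: uniform_limit_cumulative => e /small[n /filter_ex[j [sU errj]]].
  have [ls [ss cE]] := eigen_count_spectrum Hsym (shrink S r (U j)).
  exists ls; first by rewrite ss muln_gt0 cardfs_gt0 sU.
  move=> E; apply: le_trans errj; rewrite -cE ss natrM [X in _ / X]mulrC.
  exact: gF.
exists mu; split.
- by move=> j n sU; apply/supnorm_le => E; rewrite muF; exact: gF.
(* Both distribution functions lie within $e/2$ of the same normalized count, so they agree. *)
- move=> mu' est; apply: mu_uniq => E; apply/eqP; rewrite -subr_eq0 -normr_le0.
  apply/ler_addgt0Pl => e e0; rewrite addr0.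
  have [|n /filter_ex[j [sU errj]]] := small (e / 2); first by rewrite divr_gt0.
  have := gF j n E sU; have /supnorm_le/(_ E) := est j n sU.
  rewrite !ler_distl => /andP[h1 h2] /andP[h3 h4]; apply/andP; split; lra.
- apply: cvg_supnorm0 => e /small[n]; apply: filterS => j [sU errj] E.
  by rewrite muF; apply: le_trans errj; exact: gF.
Qed.
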